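(* There is a linear-time algorithm for \textsc{Tree in Binary Tree} that, given a tree $G$ on $n$ vertices, outputs a binary tree $H$ with $V(H)=V(G)$ such that $\sum_{uv\in E(G)}\operatorname{dist}_H(u,v)\le 4\cdot \mathrm{OPT}(G)$, where $\mathrm{OPT}(G)$ is the minimum of $\sum_{uv\in E(G)}\operatorname{dist}_{H'}(u,v)$ over all binary trees $H'$ with $V(H')=V(G)$.
   Context: \textsc{Tree in Binary Tree}: the input is a tree $G$; the task is to find a binary tree $H$ (a rooted tree in which every node has at most two children) with vertex set $V(H)=V(G)$ minimizing the cost $\sum_{uv\in E(G)}\operatorname{dist}_H(u,v)$, where $\operatorname{dist}_H$ is the shortest-path distance in $H$. No vertices other than those of $G$ are allowed in $H$. *)

(* Defs.v *)
From mathcomp Require Import all_boot.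
Set Implicit Arguments.
Unset Strict Implicit.
Unset Printing Implicit Defensive.

Definition connected_graph (T : finType) (e : rel T) : Prop :=
  forall u v : T, connect e u v.

Definition acyclic_graph (T : finType) (e : rel T) : Prop :=
  forall p : seq T, 2 < size p -> ~ ucycle e p.

Definition is_tree (T : finType) (e : rel T) : Prop :=
  [/\ symmetric e, irreflexive e, 0 < #|T|, connected_graph e & acyclic_graph e].

(* The least number of edges of a walk from u to v; it is #|T| if there is no
   such walk, since a shortest walk has fewer than #|T| edges. *)
Definition dist (T : finType) (e : rel T) (u v : T) : nat :=
  find (fun k => [exists p : k.-tuple T, path e u p && (last u p == v)])
       (iota 0 #|T|).

Definition children (T : finType) (h : rel T) (r v : T) : {set T} :=
  [set w | h v w & dist h r w == (dist h r v).+1].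

Definition is_binary_tree (T : finType) (h : rel T) (r : T) : Prop :=
  is_tree h /\ forall v : T, #|children h r v| <= 2.

(* Each undirected edge is counted once, from its smaller endpoint. *)
Definition cost (n : nat) (g h : rel 'I_n) : nat :=
  \sum_(p : 'I_n * 'I_n | (p.1 < p.2) && g p.1 p.2) dist h p.1 p.2.

Definition is_opt (n : nat) (g : rel 'I_n) (m : nat) : Prop :=
  (exists (h : rel 'I_n) (r : 'I_n), is_binary_tree h r /\ cost g h = m) /\
  (forall (h : rel 'I_n) (r : 'I_n), is_binary_tree h r -> m <= cost g h).

(* Programs of a random access machine, in structured form.  A program mentions
   finitely many registers, named by natural numbers; the memory is an array
   that is accessed indirectly, through an address held in a register. *)
Inductive cmd : Type :=
  | Skip
  | Const (x k : nat)
  | Add (x y z : nat)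
  | Sub (x y z : nat)
  | Read (x y : nat)
  | Write (x y : nat)
  | Seq (c1 c2 : cmd)
  | If (x : nat) (c1 c2 : cmd)
  | While (x : nat) (c : cmd).

Record state : Type := State { regs : nat -> nat; ram : nat -> nat }.

Definition set_reg (s : state) (x v : nat) : state :=
  State [eta regs s with x |-> v] (ram s).

Definition set_ram (s : state) (a v : nat) : state :=
  State (regs s) [eta ram s with a |-> v].

(* [exec W c s t s']: from s, the program c halts in s' after exactly t steps,
   every elementary instruction and every test counting for one step.  Words
   range over 0, ..., W, and an instruction that overflows has no execution;
   only Const and Add can create a value, hence also an address, exceeding all
   those already present.  Subtraction is truncated at 0. *)
Inductive exec (W : nat) : cmd -> state -> nat -> state -> Prop :=
  | ExecSkip s : exec W Skip s 1 s
  | ExecConst x k s : k <= W -> exec W (Const x k) s 1 (set_reg s x k)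
  | ExecAdd x y z s : regs s y + regs s z <= W ->
      exec W (Add x y z) s 1 (set_reg s x (regs s y + regs s z))
  | ExecSub x y z s :
      exec W (Sub x y z) s 1 (set_reg s x (regs s y - regs s z))
  | ExecRead x y s : exec W (Read x y) s 1 (set_reg s x (ram s (regs s y)))
  | ExecWrite x y s : exec W (Write x y) s 1 (set_ram s (regs s x) (regs s y))
  | ExecSeq c1 c2 s s1 s2 t1 t2 :
      exec W c1 s t1 s1 -> exec W c2 s1 t2 s2 ->
      exec W (Seq c1 c2) s (t1 + t2) s2
  | ExecIfTrue x c1 c2 s s1 t : regs s x != 0 ->
      exec W c1 s t s1 -> exec W (If x c1 c2) s t.+1 s1
  | ExecIfFalse x c1 c2 s s1 t : regs s x = 0 ->
      exec W c2 s t s1 -> exec W (If x c1 c2) s t.+1 s1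
  | ExecWhileTrue x c s s1 s2 t1 t2 : regs s x != 0 ->
      exec W c s t1 s1 -> exec W (While x c) s1 t2 s2 ->
      exec W (While x c) s (t1 + t2).+1 s2
  | ExecWhileFalse x c s : regs s x = 0 -> exec W (While x c) s 1 s.

Lemma exec_det W c s t1 s1 t2 s2 :
  exec W c s t1 s1 -> exec W c s t2 s2 -> t1 = t2 /\ s1 = s2.
Proof.
move=> E1; elim: E1 t2 s2 => {c s t1 s1} /=; intros;
  match goal with E : exec _ _ _ _ ?s2 |- _ = _ /\ _ = ?s2 =>
    inversion E; subst end;
  repeat match goal with
    | nz : is_true (regs ?s ?x != 0), z : regs ?s ?x = 0 |- _ =>
        by rewrite z in nz
    | IH : (forall t s, exec _ ?c ?s0 t s -> _), E : exec _ ?c ?s0 _ _ |- _ =>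
        case: (IH _ _ E) => ? ?; subst; clear IH
    end; by [].
Qed.

(* l lists every undirected edge of g exactly once, in one of its two
   orientations; the order and the orientations are arbitrary. *)
Definition is_edge_list (n : nat) (g : rel 'I_n) (l : seq ('I_n * 'I_n)) : Prop :=
  [/\ uniq l,
      forall u v : 'I_n, g u v = ((u, v) \in l) || ((v, u) \in l) &
      forall u v : 'I_n, (u, v) \in l -> (v, u) \notin l].

(* The input graph in memory: the number n of vertices in cell 0, followed by
   the endpoints of the listed edges.  All other cells and registers hold 0. *)
Definition input_state (n : nat) (l : seq ('I_n * 'I_n)) : state :=
  State (fun=> 0)
        (nth 0 (n :: flatten [seq [:: val p.1; val p.2] | p <- l])).

(* The output tree in memory: the root in cell 0 and, for every other vertex v,
   its parent in cell v.+1. *)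
Definition represents (n : nat) (s : state) (h : rel 'I_n) (r : 'I_n) : Prop :=
  ram s 0 = r /\ forall p v : 'I_n, v \in children h r p -> ram s v.+1 = p.

(* Main.v *)
(* Root G at vertex 0, and let c_0, c_1, ... be the children of p in the order in
   which they are pruned as leaves.  In H, c_0 hangs below p, and c_i hangs below
   q = c_(i/2) if i > 0 is even and below the first child of q (below q itself if
   q is a leaf of G) if i is odd.  A vertex then has at most two children in H,
   and dist_H(p, c_i) <= D(i) with D(0) = 1 and D(i) = D(i/2) + 1 + (i mod 2).
   In a binary tree the ball of radius t has at most 3 (2^t - 1) vertices besides
   its center, so the d neighbors of a vertex of G lie at total distance at least
   f(d), the sum over the d closest vertices of the infinite 3-regular tree.
   Since D(0) + ... + D(k-1) <= 2 f(k) + 2 k and f(k+1) >= f(k) + 1, while the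
   numbers k of children add up to n - 1, the cost of H is at most 2 sum_v f(deg v),
   which is at most 4 OPT because every edge has two ends.

   The machine prunes leaves from the degrees and the sums modulo n of the remaining
   neighbors: for a leaf this sum is its parent.  The vertex c_(i/2) is maintained
   by a pointer into the linked list of the children of p pruned so far. *)

Require Import Defs.
From mathcomp Require Import all_boot zify.
From Stdlib Require Import Classical_Prop.
Import Defs.
Set Implicit Arguments.
Unset Strict Implicit.
Unset Printing Implicit Defensive.

(** * Distances in trees *)

Definition walk (T : finType) (e : rel T) (k : nat) (u v : T) : Prop :=
  exists p : seq T, [/\ size p = k, path e u p & last u p = v].

Lemma dist_le (T : finType) (e : rel T) k u v : walk e k u v -> dist e u v <= k.
Proof.
case=> p [sz pth lst]; rewrite /dist; case: (ltnP k #|T|) => hk; last first.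
  (* A failed search returns the length [#|T|] of the list, so the bound is automatic for [k] at
     least [#|T|]. *)
  by apply: leq_trans (find_size _ _) _; rewrite size_iota.
rewrite leqNgt; apply/negP => /(before_find 0).
rewrite nth_iota // add0n => /negbT /negP; apply; apply/existsP.
by exists (Tuple (introT eqP sz)); rewrite /= pth lst eqxx.
Qed.

(** Shortening a path until it is duplicate-free brings its length below [#|T|], so the search in
    [dist] succeeds. *)
Lemma dist_walk (T : finType) (e : rel T) u v :
  connect e u v -> walk e (dist e u v) u v.
Proof.
move=> /connectP [p pth ->]; case: (shortenP pth) => q qpth uq _ {p pth}.
rewrite /dist; set a := (a in find a _).
have hq : has a (iota 0 #|T|).
  apply/hasP; exists (size q).
    rewrite mem_iota add0n /=.
    by have := max_card (mem (u :: q)); rewrite (card_uniqP uq).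
  by apply/existsP; exists (in_tuple q); rewrite /= qpth eqxx.
have := nth_find 0 hq; rewrite has_find size_iota in hq.
rewrite nth_iota // add0n => /existsP [p /andP [pp /eqP lp]].
by exists p; rewrite size_tuple.
Qed.

Lemma walk_cat (T : finType) (e : rel T) j k u v w :
  walk e j u v -> walk e k v w -> walk e (j + k) u w.
Proof.
move=> [p [sp pp lp]] [q [sq pq lq]]; exists (p ++ q).
by rewrite size_cat sp sq cat_path pp last_cat lp.
Qed.

Lemma walk_edge (T : finType) (e : rel T) u v : e u v -> walk e 1 u v.
Proof. by move=> h; exists [:: v]; rewrite /= h. Qed.

Lemma walk_sym (T : finType) (e : rel T) k u v :
  symmetric e -> walk e k u v -> walk e k v u.
Proof.
move=> se [p [sp pp lp]]; exists (rev (belast u p)); split.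
- by rewrite size_rev size_belast.
- by rewrite -lp rev_path (eq_path (e' := e)) // => x y; apply: se.
- by case: (p) lp => [<-|x q] //= _; rewrite rev_cons last_rcons.
Qed.

Lemma distxx (T : finType) (e : rel T) u : dist e u u = 0.
Proof. by apply/eqP; rewrite -leqn0; apply: dist_le; exists [::]. Qed.

Lemma dist_sym (T : finType) (e : rel T) u v :
  symmetric e -> connected_graph e -> dist e u v = dist e v u.
Proof.
move=> se ce; apply/eqP; rewrite eqn_leq.
by apply/andP; split; apply/dist_le/walk_sym => //; apply: dist_walk.
Qed.

Lemma dist_triangle (T : finType) (e : rel T) u v w :
  connected_graph e -> dist e u w <= dist e u v + dist e v w.
Proof. by move=> ce; apply/dist_le/walk_cat; apply/dist_walk/ce. Qed.

Lemma dist_edge (T : finType) (e : rel T) r u v :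
  connected_graph e -> e u v -> dist e r v <= (dist e r u).+1.
Proof.
move=> ce euv; rewrite -addn1; apply/dist_le/walk_cat/walk_edge/euv.
exact/dist_walk/ce.
Qed.

Lemma dist_gt0 (T : finType) (e : rel T) u v :
  connected_graph e -> u != v -> 0 < dist e u v.
Proof.
move=> ce; rewrite lt0n; apply: contra => /eqP d0.
by have [p [/eqP]] := dist_walk (ce u v); rewrite d0 size_eq0 => /eqP -> _ /= ->.
Qed.

Lemma dist_pred (T : finType) (e : rel T) r v :
  connected_graph e -> v != r -> exists2 u, e u v & dist e r v = (dist e r u).+1.
Proof.
move=> ce vr; have [p [sp pp lp]] := dist_walk (ce r v).
case/lastP: p sp pp lp => [_ _ /= rv|q x]; first by rewrite rv eqxx in vr.
rewrite size_rcons rcons_path last_rcons => sp /andP [pq eqx] xv.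
rewrite {}xv in eqx; exists (last r q) => //.
apply/eqP; rewrite eqn_leq dist_edge // -sp ltnS.
by apply: dist_le; exists q.
Qed.

(** A duplicate-free [e']-path from [u] to [v] would be closed by the edge [uv] to a cycle of [e];
    it has an inner vertex because [uv] is missing from [e']. *)
Lemma acyclic_bridge (T : finType) (e e' : rel T) u v :
  symmetric e -> acyclic_graph e -> subrel e' e -> u != v -> e u v ->
  ~~ e' u v -> ~~ connect e' u v.
Proof.
move=> se ae sub uv euv ne'; apply/negP => /connectP [p pth].
case: (shortenP pth) => q qpth uq _ {p pth} lq.
apply: (ae (u :: q)); last first.
  rewrite /ucycle uq andbT /= rcons_path (sub_path sub qpth) /= -lq.
  by rewrite se.
case: q qpth uq lq => [|x [|y q]] //=.
  by move=> _ _ vu; rewrite vu eqxx in uv.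
by rewrite andbT => h _ vx; rewrite -vx (negPf ne') in h.
Qed.

(** Shortest walks from [r] to [x] and to [y] avoid [v]. If [x] and [y] differed, the route from [v]
    over [y] and [r] to [x] would bypass the edge [vx], against [acyclic_bridge]. Here [e'] deletes
    the vertex [v] and [e''] only the edge [vx]. *)
Lemma tree_lower_neighbor (T : finType) (e : rel T) r v x y :
  is_tree e -> e v x -> e v y -> dist e r x <= dist e r v ->
  dist e r y <= dist e r v -> x = y.
Proof.
move=> [se ie _ ce ae] vx vy dx dy; apply/eqP/negP => /negP xy.
pose e' := [rel a b | e a b && ((a != v) && (b != v))].
pose e'' := [rel a b | e a b && ~~ (((a == v) && (b == x)) || ((a == x) && (b == v)))].
have nv z : e v z -> z != v by move=> h; apply/eqP => zv; rewrite zv ie in h.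
have conn d : forall z, dist e r z <= d -> d <= dist e r v -> z != v ->
    connect e' r z.
  elim: d => [|d IH] z dz dv zv.
    case: (eqVneq z r) => [->|/dist_gt0 h]; first exact: connect0.
    by move: dz; rewrite leqNgt (dist_sym _ _ se ce) h.
  case: (eqVneq z r) => [->|zr]; first exact: connect0.
  have [u uz du] := dist_pred ce zr.
  have uv : u != v by apply/eqP => uv; move: dz; rewrite du uv; lia.
  apply: (connect_trans (IH u _ _ uv)); try lia.
  by apply: connect1; rewrite /e' /= uz uv zv.
have se' : connect_sym e'.
  by apply: sym_connect_sym => a b; rewrite /e' /= se [(a != v) && _]andbC.
have sub'' : subrel e' e''.
  move=> a b /= /andP [-> /andP [av bv]].
  by rewrite (negPf av) (negPf bv) andbF.
apply: (negP (@acyclic_bridge T e e'' v x se ae _ _ vx _)).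
- by move=> a b /= /andP [].
- by rewrite eq_sym nv.
- by rewrite /= !eqxx andbF.
apply: (connect_trans (y := y)).
  by apply: connect1; rewrite /= vy (negPf (nv _ vy)) (eq_sym y) (negPf xy) !andbF.
apply: (connect_sub (e := e')) => [a b /sub'' h|]; first exact: connect1.
apply: (connect_trans (y := r)); last exact: conn dx (leqnn _) (nv _ vx).
by rewrite se'; apply: conn dy (leqnn _) (nv _ vy).
Qed.

(** No vertex qualifies for the root, which therefore is its own parent. *)
Definition gparent (T : finType) (e : rel T) (r v : T) : T :=
  odflt v [pick u | e u v && (dist e r v == (dist e r u).+1)].

Lemma gparentP (T : finType) (e : rel T) r v : connected_graph e -> v != r ->
  e (gparent e r v) v /\ dist e r v = (dist e r (gparent e r v)).+1.
Proof.
move=> ce vr; rewrite /gparent; case: pickP => [u /andP [h /eqP]//|h].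
by have [u uv /eqP du] := dist_pred ce vr; move: (h u); rewrite uv du.
Qed.

(** The parent is a neighbor closer to [r], and [tree_lower_neighbor] allows only one neighbor that
    is not farther; so the nearer end of an edge is the parent of the other. *)
Lemma gparent_edge (T : finType) (e : rel T) r u v : is_tree e -> e u v =
  ((u != r) && (gparent e r u == v)) || ((v != r) && (gparent e r v == u)).
Proof.
move=> te; have [se ie _ ce ae] := te.
suff key a b : e a b -> dist e r a <= dist e r b ->
    (b != r) && (gparent e r b == a).
  apply/idP/idP => [euv|].
    case: (leqP (dist e r u) (dist e r v)) => h; first by rewrite (key u) ?orbT.
    by rewrite (key v u) // ?(ltnW h) // se.
  case/orP => /andP [nr /eqP <-]; last by case: (gparentP ce nr).
  by rewrite se; case: (gparentP ce nr).
move=> eab dab; have br : b != r.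
  apply/eqP => br; move: dab; rewrite br distxx leqNgt dist_gt0 // eq_sym.
  by apply/eqP => ar; rewrite br ar ie in eab.
have [h1 h2] := gparentP ce br; rewrite br /=; apply/eqP.
by apply: (tree_lower_neighbor te) dab; rewrite 1?se // h2.
Qed.

(** * Sizes of spheres and balls in binary trees *)

Definition nbrs (T : finType) (e : rel T) (v : T) : {set T} := [set u | e v u].

Lemma binary_nbrs (T : finType) (h : rel T) r v :
  is_binary_tree h r -> #|nbrs h v| <= 3.
Proof.
move=> [th bh]; have [sh ih _ ch _] := th.
have sub : nbrs h v \subset gparent h r v |: children h r v.
  apply/subsetP => u; rewrite inE (gparent_edge r v u th) !inE.
  case/orP => /andP [nr /eqP gp]; first by rewrite gp eqxx.
  have [h1 h2] := gparentP ch nr; rewrite gp in h1 h2.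
  by rewrite h1 h2 eqxx orbT.
apply: (leq_trans (subset_leq_card sub)).
by rewrite cardsU1; have := bh v; case: (_ \notin _) => /=; lia.
Qed.

Lemma card_fibers (I J : finType) (A : {set I}) (B : {set J}) (f : I -> J) m :
  (forall i, i \in A -> f i \in B) ->
  (forall j, j \in B -> #|[set i in A | f i == j]| <= m) -> #|A| <= m * #|B|.
Proof.
move=> fAB fib; rewrite -sum1_card (partition_big f (mem B)) //=.
rewrite mulnC -sum_nat_const; apply: leq_sum => j jB.
by rewrite sum1dep_card; apply: leq_trans (fib j jB); rewrite subset_leq_card.
Qed.

(** Rerooted at [v], each vertex other than [v] spends one of its at most three neighbors on its
    parent, so the parent map from a sphere to the previous one has fibers of size at most 2. *)
Lemma sphere_card (T : finType) (h : rel T) r v t : is_binary_tree h r ->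
  #|[set u | dist h v u == t.+1]| <= 3 * 2 ^ t.
Proof.
move=> bh; have [th _] := bh; have [sh _ _ ch _] := th.
have sphere d u : u \in [set u | dist h v u == d.+1] -> u != v.
  by rewrite inE; apply: contraTneq => ->; rewrite distxx.
elim: t => [|t IH].
  rewrite muln1; apply: leq_trans (binary_nbrs v bh); apply: subset_leq_card.
  apply/subsetP => u uS; have uv := sphere _ _ uS; move: uS; rewrite !inE.
  have [h1 h2] := gparentP ch uv; rewrite h2 eqSS => d0.
  case: (eqVneq v (gparent h v u)) => [->//|/(dist_gt0 ch)].
  by rewrite (eqP d0).
rewrite expnS mulnCA; apply: leq_trans (leq_mul (leqnn 2) IH).
apply: (card_fibers (f := gparent h v)) => [u uS|u].
  have [_ h2] := gparentP ch (sphere _ _ uS); move: uS.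
  by rewrite !inE h2 eqSS.
move=> uS; have uv := sphere _ _ uS; have [h1 h2] := gparentP ch uv.
have sub : gparent h v u |: [set i in [set u0 | dist h v u0 == t.+2] | gparent h v i == u]
     \subset nbrs h u.
  apply/subsetP => w; rewrite !inE => /orP [/eqP ->|]; first by rewrite sh.
  case/andP => dw /eqP gw.
  have wv : w != v by apply: contraTneq dw => ->; rewrite distxx.
  by have [hw _] := gparentP ch wv; rewrite gw in hw.
have := leq_trans (subset_leq_card sub) (binary_nbrs u bh).
rewrite cardsU1 !inE.
suff -> : dist h v (gparent h v u) == t.+2 = false by rewrite /= add1n.
by move: uS; rewrite inE; lia.
Qed.

Lemma ball_card (T : finType) (h : rel T) r v t : is_binary_tree h r ->
  #|[set u | (u != v) && (dist h v u <= t)]| <= 3 * (2 ^ t - 1).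
Proof.
move=> bh; have [th _] := bh; have [_ _ _ ch _] := th.
elim: t => [|t IH].
  rewrite leqn0 cards_eq0; apply/eqP/setP => u; rewrite !inE.
  by case: eqVneq => //= uv; rewrite leqNgt dist_gt0 // eq_sym.
apply: (@leq_trans (3 * (2 ^ t - 1) + 3 * 2 ^ t)).
  apply: leq_trans (leq_add IH (sphere_card v t bh)).
  rewrite -cardsUI; apply: leq_trans (leq_addr _ _); apply: subset_leq_card.
  apply/subsetP => u; rewrite !inE => /andP [-> /=].
  by rewrite leq_eqVlt ltnS orbC.
by rewrite expnS; have := expn_gt0 2 t; lia.
Qed.

(** * The degree-3 lower bound and the slot depths *)

(* The distance of the i-th closest vertex (from 0) in the infinite 3-regular tree,
   whose balls of radius t have 3 * (2 ^ t - 1) vertices besides the center. *)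
Definition cubic_dist (i : nat) : nat := (trunc_log 2 (i %/ 3).+1).+1.

Definition cubic_sum (d : nat) : nat := \sum_(i < d) cubic_dist i.

Lemma cubic_dist_le i : 3 * (2 ^ (cubic_dist i).-1 - 1) <= i.
Proof.
have := @trunc_logP 2 (i %/ 3).+1 isT isT; rewrite /cubic_dist /=.
by have := leq_trunc_div i 3; lia.
Qed.

(** The hypothesis at least doubles [m %/ 3 + 1], which raises its logarithm by one. *)
Lemma cubic_dist_double m i : 2 * m + 3 <= i -> (cubic_dist m).+1 <= cubic_dist i.
Proof.
move=> hi; rewrite /cubic_dist !ltnS; apply: trunc_log_max => //.
have := @trunc_logP 2 (m %/ 3).+1 isT isT; rewrite expnS.
by have := leq_trunc_div m 3; have := ltn_ceil i (isT : 0 < 3); lia.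
Qed.

Lemma cubic_dist_leq i j : i <= j -> cubic_dist i <= cubic_dist j.
Proof. by move=> ij; rewrite ltnS leq_trunc_log // ltnS leq_div2r. Qed.

(** This is the slack that the induction of [slot_sum_le] consumes: a logarithm against a linear
    function, with 27 matching the cutoff 58 there. *)
Lemma cubic_dist_linear m : 27 <= m -> 6 * cubic_dist m.+1 <= m + 3.
Proof.
move=> hm; have := cubic_dist_le m.+1; set x := cubic_dist _.
case: (leqP x 4) => [|hx] le_m; first by lia.
suff: 2 * x + 1 <= 2 ^ x.-1 by lia.
rewrite -(subnK hx) /=; elim: (x - 5) => // k IH.
have -> : (k.+1 + 5).-1 = (k + 5).-1.+1 by lia.
by rewrite expnS; lia.
Qed.

Lemma cubic_sumS d : cubic_sum d.+1 = cubic_sum d + cubic_dist d.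
Proof. by rewrite /cubic_sum big_ord_recr. Qed.

Lemma cubic_sum0 : cubic_sum 0 = 0.
Proof. by rewrite /cubic_sum big_ord0. Qed.

(** The indices 0, 1, 2 contribute 1 each; each of the indices [2 * i + 3] and [2 * i + 4]
    contributes at least one more than [i]. *)
Lemma cubic_sum_odd m : 3 + 2 * cubic_sum m + 2 * m <= cubic_sum (2 * m + 3).
Proof.
elim: m => [|m IH]; first by rewrite !cubic_sumS cubic_sum0.
have -> : 2 * m.+1 + 3 = (2 * m + 3).+2 by lia.
rewrite !cubic_sumS.
have h1 := @cubic_dist_double m (2 * m + 3) (leqnn _).
by have h2 := @cubic_dist_double m (2 * m + 3).+1 (leqnSn _); lia.
Qed.

Lemma cubic_sum_even m :
  cubic_sum m + cubic_sum m.+1 + 2 * m + 4 <= cubic_sum (2 * m + 4).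
Proof.
have := cubic_sum_odd m; have -> : 2 * m + 4 = (2 * m + 3).+1 by lia.
rewrite !cubic_sumS.
by have := @cubic_dist_double m (2 * m + 3) (leqnn _); lia.
Qed.

Lemma leq_cubic_sumS d : cubic_sum d + 1 <= cubic_sum d.+1.
Proof. by rewrite cubic_sumS leq_add2l. Qed.

(** Greedy from the top: [N] lies in the ball whose radius is the value of its farthest element, so
    the ball bound forces this value up to [cubic_dist (#|N| - 1)]. Removing that element preserves
    the hypothesis. *)
Lemma cubic_sum_min (T : finType) (N : {set T}) (f : T -> nat) :
  (forall t, #|[set u in N | f u <= t]| <= 3 * (2 ^ t - 1)) ->
  cubic_sum #|N| <= \sum_(u in N) f u.
Proof.
move: {2}#|N| (erefl #|N|) => d; elim: d N => [|d IH] N dN hN.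
  by rewrite dN cubic_sum0.
have [x0 x0N] : exists x0, x0 \in N by apply/set0Pn; rewrite -card_gt0 dN.
case: (@arg_maxnP _ x0 (mem N) f x0N) => x xN xmax; rewrite /= in xN.
rewrite (big_setD1 x) //= dN cubic_sumS addnC.
have dNx : #|N :\ x| = d by have := cardsD1 x N; rewrite xN dN => -[].
apply: leq_add; last first.
  rewrite -dNx; apply: IH => // t; apply: leq_trans (hN t).
  by apply: subset_leq_card; apply/subsetP => u; rewrite !inE => /andP [/andP [_ ->]].
have: N \subset [set u in N | f u <= f x].
  by apply/subsetP => u uN; rewrite inE uN /=; apply: xmax.
move/subset_leq_card/leq_trans/(_ (hN _)); rewrite dN => lt_d.
rewrite leqNgt; apply/negP => h.
have hx : f x <= (cubic_dist d).-1 by lia.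
have := leq_pexp2l (isT : 0 < 2) hx; have := cubic_dist_le d.
by move: lt_d; lia.
Qed.

Lemma cubic_sum_nbrs (T : finType) (h : rel T) r v (N : {set T}) :
  is_binary_tree h r -> v \notin N ->
  cubic_sum #|N| <= \sum_(u in N) dist h v u.
Proof.
move=> bh vN; apply: cubic_sum_min => t; apply: leq_trans (ball_card v t bh).
apply: subset_leq_card; apply/subsetP => u; rewrite !inE => /andP [uN ->].
by rewrite andbT; apply: contraNneq vN => <-.
Qed.

(** The function [D] of the overview. Its argument is halved in each call, so fuel [i] suffices for
    [i]. *)
Fixpoint slot_depth_rec (fuel i : nat) : nat :=
  if fuel is fuel'.+1 then
    if i == 0 then 1 else slot_depth_rec fuel' i./2 + (odd i).+1
  else 1.

(* Bounds the distance in H from p to its i-th child in G, counting from 0. *)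
Definition slot_depth (i : nat) : nat := slot_depth_rec i i.

Definition slot_sum (k : nat) : nat := \sum_(i < k) slot_depth i.

Lemma slot_depth_recE fuel i : i <= fuel -> slot_depth_rec fuel i = slot_depth i.
Proof.
rewrite /slot_depth; elim/ltn_ind: i fuel => i IH [|fuel]; first by case: i {IH}.
case: i IH => [|i] IH //= hi.
by rewrite !IH //; lia.
Qed.

Lemma slot_depthE i : 0 < i -> slot_depth i = slot_depth i./2 + (odd i).+1.
Proof.
by case: i => // i _; rewrite {1}/slot_depth /= slot_depth_recE //; lia.
Qed.

Lemma slot_depth_even m : 0 < m -> slot_depth (2 * m) = slot_depth m + 1.
Proof.
move=> m0; rewrite slot_depthE; last by lia.
by rewrite mul2n odd_double doubleK.
Qed.

Lemma slot_depth_odd m : slot_depth (2 * m).+1 = slot_depth m + 2.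
Proof. by rewrite slot_depthE // mul2n /= odd_double /= uphalf_double. Qed.

Lemma slot_sumS k : slot_sum k.+1 = slot_sum k + slot_depth k.
Proof. by rewrite /slot_sum big_ord_recr. Qed.

Lemma slot_sum0 : slot_sum 0 = 0.
Proof. by rewrite /slot_sum big_ord0. Qed.

(** The indices [2 * i] and [2 * i + 1] contribute [2 * D(i) + 3] together, except for one less at
    [i = 0]. *)
Lemma slot_sum_even m : slot_sum (2 * m.+1) + 1 = 2 * slot_sum m.+1 + 3 * m.+1.
Proof.
elim: m => [|m IH]; first by rewrite !slot_sumS slot_sum0.
have -> : 2 * m.+2 = (2 * m.+1).+2 by lia.
rewrite [in RHS]slot_sumS !(slot_sumS (2 * m.+1).+1) (slot_sumS (2 * m.+1)).
rewrite slot_depth_even // slot_depth_odd.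
by move: IH; lia.
Qed.

Lemma slot_sum_odd m :
  slot_sum (2 * m.+1).+1 = slot_sum m.+1 + slot_sum m.+2 + 3 * m.+1.
Proof.
rewrite (slot_sumS (2 * m.+1)) slot_depth_even // (slot_sumS m.+1).
by have := slot_sum_even m; lia.
Qed.

(** Both sums satisfy halving recursions. Inserting the bounds for the halves leaves at most
    [6 * cubic_dist m.+1 <= m + 3] to show, where [k] is [2 * m + 3] or [2 * m + 4]; the values
    below 58 are computed. *)
Lemma slot_sum_le k : slot_sum k <= 2 * cubic_sum k + 2 * k.
Proof.
elim/ltn_ind: k => k IH; case: (ltnP k 58) => hk.
  have unroll (F : nat -> nat) d : \sum_(i < d) F i = sumn (map F (iota 0 d)).
    by rewrite sumnE big_map -(big_mkord predT) /index_iota subn0.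
  have: all (fun d => sumn (map slot_depth (iota 0 d)) <=
      2 * sumn (map cubic_dist (iota 0 d)) + 2 * d) (iota 0 58) by vm_compute.
  by move/allP/(_ k); rewrite mem_iota /slot_sum /cubic_sum !unroll; apply.
have [m [hm [km|km]]] : exists m, 27 <= m /\ (k = (2 * m.+1).+1 \/ k = 2 * m.+2).
- by exists (k - 3)./2; lia.
- rewrite km slot_sum_odd; have h1 := IH m.+1; have h2 := IH m.+2.
  have := cubic_sum_odd m; have -> : 2 * m + 3 = (2 * m.+1).+1 by lia.
  have := cubic_dist_linear hm; have := cubic_dist_leq (leqnSn m).
  by move: (cubic_sumS m) (cubic_sumS m.+1) h1 h2; lia.
have := slot_sum_even m.+1; rewrite km; have h1 := IH m.+2.
have := cubic_sum_even m; have -> : 2 * m + 4 = 2 * m.+2 by lia.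
have := cubic_dist_linear hm; have := cubic_dist_leq (leqnSn m).
by move: (cubic_sumS m) (cubic_sumS m.+1) h1; lia.
Qed.

(** * The approximating tree *)

Definition parent_graph (T : finType) (r : T) (par : T -> T) : rel T :=
  fun u v => ((u != r) && (par u == v)) || ((v != r) && (par v == u)).

(** Weighted depth along parent pointers; the decreasing potential [phi] provides the fuel. *)
Lemma parent_recursion (T : finType) (r : T) (par : T -> T) (phi a : T -> nat) :
  (forall v, v != r -> phi (par v) < phi v) ->
  exists2 F : T -> nat, F r = 0 & forall v, v != r -> F v = F (par v) + a v.
Proof.
move=> dec.
pose F := fix F k v := if k is k'.+1 then
  if v == r then 0 else F k' (par v) + a v else 0.
have FE k v : phi v < k -> F k v = F (phi v).+1 v.
  elim/ltn_ind: k v => -[|k] // IH v /=.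
  case: (eqVneq v r) => //= vr hk; have := dec v vr => hv.
  by congr addn; rewrite (IH k) ?(IH (phi v)) //; lia.
exists (fun v => F (phi v).+1 v) => /= [|v vr]; first by rewrite eqxx.
by rewrite (negPf vr) FE ?dec.
Qed.

Lemma parent_graph_sym (T : finType) (r : T) par : symmetric (parent_graph r par).
Proof. by move=> u v; rewrite /parent_graph orbC. Qed.

Lemma parent_graph_connected (T : finType) (r : T) par (phi : T -> nat) :
  (forall v, v != r -> phi (par v) < phi v) ->
  connected_graph (parent_graph r par).
Proof.
move=> dec; have sc := sym_connect_sym (parent_graph_sym r par).
have to_r v : connect (parent_graph r par) r v.
  have [k] := ubnP (phi v); elim: k v => // k IH v hv.
  case: (eqVneq v r) => [->|vr]; first exact: connect0.
  apply: (connect_trans (IH (par v) _)); first by have := dec v vr; lia.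
  by apply: connect1; rewrite /parent_graph vr eqxx orbT.
by move=> u v; apply: connect_trans (to_r v); rewrite sc.
Qed.

(** The distance from [r] equals the depth [F]: climbing the pointers gives one inequality, and [F]
    grows by at most 1 per edge of a walk, which gives the other. *)
Lemma parent_graph_dist (T : finType) (r : T) par (phi : T -> nat) :
  (forall v, v != r -> phi (par v) < phi v) ->
  forall v, v != r ->
    dist (parent_graph r par) r v = (dist (parent_graph r par) r (par v)).+1.
Proof.
move=> dec; have cg := parent_graph_connected dec.
have [F F0 FS] := parent_recursion (fun=> 1) dec.
suff dF v : dist (parent_graph r par) r v = F v.
  by move=> v vr; rewrite !dF FS ?addn1.
apply/eqP; rewrite eqn_leq; apply/andP; split.
  have [k] := ubnP (phi v); elim: k v => // k IH v hv.
  case: (eqVneq v r) => [->|vr]; first by rewrite distxx.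
  rewrite FS // addn1; apply: (leq_trans (@dist_edge _ _ r (par v) v cg _)).
    by rewrite /parent_graph vr eqxx orbT.
  by rewrite ltnS IH //; have := dec v vr; lia.
have [p [<- pp <-]] := dist_walk (cg r v).
suff gen u : path (parent_graph r par) u p -> F (last u p) <= F u + size p.
  by have := gen r pp; rewrite F0.
elim: p u {pp} => [|x p IH] u /=; first by rewrite addn0.
case/andP => ux /IH h; suff: F x <= (F u).+1 by lia.
by case/orP: ux => /andP [nr /eqP <-]; rewrite (FS _ nr); lia.
Qed.

Lemma parent_graph_tree (T : finType) (r : T) par (phi : T -> nat) :
  (forall v, v != r -> phi (par v) < phi v) -> is_tree (parent_graph r par).
Proof.
move=> dec; have [F _ FS] := parent_recursion (fun=> 1) dec; split.
- exact: parent_graph_sym.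
- move=> v; rewrite /parent_graph orbb; apply/negP => /andP [vr /eqP pv].
  by have := dec v vr; rewrite pv ltnn.
- by apply/card_gt0P; exists r.
- exact: parent_graph_connected dec.
have up u v : parent_graph r par u v -> F v <= F u -> par u = v.
  case/orP => /andP [nr /eqP pv] //.
  by rewrite (FS v nr) pv; lia.
(* On a cycle, both cycle neighbors of a deepest vertex [x] would have to be its parent, yet they
   are distinct. *)
move=> p sp /andP [cp up_p].
have [x0 x0p] : exists x, x \in p by case: p sp {cp up_p} => // x p _; exists x; rewrite mem_head.
case: (@arg_maxnP _ x0 (mem p) F x0p) => x; rewrite /= => xp xmax.
have [i s def_s] := rot_to xp; move: cp up_p; rewrite -(rot_cycle i) -(rot_uniq i).
have {xmax} xmax z : z \in x :: s -> F z <= F x.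
  by rewrite -def_s mem_rot; apply: xmax.
have {sp} ss : 1 < size s by rewrite -(size_rot i) def_s /= in sp.
rewrite {}def_s; case: s ss xmax => [|y s] //= ss xmax.
rewrite rcons_path => /and3P [xy pys sx] /and3P [_ ys _].
have := up _ _ xy (xmax y _); rewrite !inE eqxx orbT => /(_ isT) xy'.
have := up x (last y s) _ (xmax _ _).
rewrite parent_graph_sym sx inE mem_last orbT => /(_ isT isT).
by rewrite xy' => ly; case: s ss ys ly {pys sx xmax} => //= z s _ + ly; rewrite ly mem_last.
Qed.

Lemma parent_graph_children (T : finType) (r : T) par (phi : T -> nat) p :
  (forall v, v != r -> phi (par v) < phi v) ->
  children (parent_graph r par) r p = [set v | (v != r) && (par v == p)].
Proof.
move=> dec; have hd := parent_graph_dist dec.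
apply/setP => v; rewrite !inE; apply/andP/andP => [[]|[vr /eqP <-]].
  case/orP => /andP [nr /eqP <-] //.
  by have := hd p nr; lia.
by rewrite {1}/parent_graph vr eqxx orbT -hd.
Qed.

(** With [s] the pruning order, this is the sequence [c_0, c_1, ...] of the overview. *)
Definition kids (T : eqType) (gp : T -> T) (s : seq T) (p : T) : seq T :=
  [seq y <- s | gp y == p].

Definition rank_of (T : eqType) (gp : T -> T) (s : seq T) (y : T) : nat :=
  index y (kids gp s (gp y)).

(** The parent in [H]. The default [q] of [head] implements the case that [q] is a leaf of [G]. *)
Definition slot_parent (T : eqType) (gp : T -> T) (s : seq T) (y : T) : T :=
  let i := rank_of gp s y in
  if i == 0 then gp y else
  let q := nth y (kids gp s (gp y)) i./2 in
  if odd i then head q (kids gp s q) else q.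

Lemma mem_kids (T : eqType) (gp : T -> T) s p y :
  (y \in kids gp s p) = (gp y == p) && (y \in s).
Proof. by rewrite mem_filter. Qed.

Lemma kids_rcons (T : eqType) (gp : T -> T) s w p : kids gp (rcons s w) p =
  if gp w == p then rcons (kids gp s p) w else kids gp s p.
Proof. by rewrite /kids filter_rcons. Qed.

(** * The tree [H]: it is binary and keeps children near their parents in [G] *)

Section SlotTree.

Variables (T : finType) (r : T) (gp : T -> T) (psi : T -> nat) (s : seq T).
Hypothesis gp_dec : forall v, v != r -> psi (gp v) < psi v.
Hypothesis uniq_s : uniq s.
Hypothesis mem_s : forall y, (y \in s) = (y != r).

Let par := slot_parent gp s.
Let H := parent_graph r par.

Lemma uniq_kids p : uniq (kids gp s p).
Proof. exact: filter_uniq. Qed.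

Lemma rank_nth x0 p i : i < size (kids gp s p) ->
  rank_of gp s (nth x0 (kids gp s p) i) = i.
Proof.
move=> hi; have := mem_nth x0 hi; rewrite mem_kids /rank_of.
by case/andP => /eqP -> _; rewrite index_uniq ?uniq_kids.
Qed.

Lemma kidP x0 y : y != r ->
  rank_of gp s y < size (kids gp s (gp y)) /\
  nth x0 (kids gp s (gp y)) (rank_of gp s y) = y.
Proof.
move=> yr; have yk : y \in kids gp s (gp y) by rewrite mem_kids eqxx mem_s.
by rewrite index_mem nth_index.
Qed.

Lemma slot_parentP y : y != r -> rank_of gp s y != 0 ->
  exists q, [/\ q != r, gp q = gp y, rank_of gp s q = (rank_of gp s y)./2 &
    par y = if odd (rank_of gp s y) then head q (kids gp s q) else q].
Proof.
move=> yr i0; have [hi _] := kidP y yr.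
have hi2 : (rank_of gp s y)./2 < size (kids gp s (gp y)) by lia.
exists (nth y (kids gp s (gp y)) (rank_of gp s y)./2).
have := mem_nth y hi2; rewrite mem_kids mem_s => /andP [/eqP e1 e2].
by split=> //; rewrite ?rank_nth // /par /slot_parent (negPf i0).
Qed.

Lemma head_kids q z : head q (kids gp s q) = z -> z != q ->
  [/\ z != r, gp z = q & rank_of gp s z = 0].
Proof.
case E: (kids gp s q) => [|x l] /= <-; first by rewrite eqxx.
move=> _; have: x \in kids gp s q by rewrite E mem_head.
rewrite mem_kids mem_s => /andP [/eqP gx xr]; split=> //.
by rewrite /rank_of gx E /= eqxx.
Qed.

(* The potential that grows by 1 + 2 * rank along the edges of G decreases from y to
   its earlier sibling q, and even to the first child of q, which exceeds q by 1. *)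
Lemma slot_parent_dec : exists phi : T -> nat, forall v, v != r -> phi (par v) < phi v.
Proof.
have [F _ FS] := parent_recursion (fun y => 1 + 2 * rank_of gp s y) gp_dec.
exists F => y yr; case: (eqVneq (rank_of gp s y) 0) => i0.
  by rewrite /par /slot_parent i0 /= (FS y yr); lia.
have [q [qr gq rq ->]] := slot_parentP yr i0.
rewrite (FS y yr) -gq; have Fq := FS q qr; rewrite rq in Fq.
case: ifP => oi; last by lia.
case: (eqVneq (head q (kids gp s q)) q) => [->|nq]; first by lia.
have [hr gh rh] := head_kids (erefl _) nq.
by rewrite (FS _ hr) gh rh; lia.
Qed.

(** The candidate [x1] is the first child of [v] or, if [v] is a leaf of [G], the sibling of odd
    rank assigned to [v]. The candidate [x2] is the sibling of even rank assigned to [v] or, if [v]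
    is itself a first child, the sibling of [gp v] of odd rank that was passed down to [v]. *)
Lemma slot_fiber v : #|[set y | (y != r) && (par y == v)]| <= 2.
Proof.
pose x1 := if kids gp s v is z :: _ then z else
  nth v (kids gp s (gp v)) (2 * rank_of gp s v).+1.
pose x2 := if rank_of gp s v == 0 then
    nth v (kids gp s (gp (gp v))) (2 * rank_of gp s (gp v)).+1
  else nth v (kids gp s (gp v)) (2 * rank_of gp s v).
apply: (@leq_trans #|[set x1; x2]|); last by rewrite cards2; case: (_ != _).
apply: subset_leq_card; apply/subsetP => y; rewrite !inE => /andP [yr /eqP pv].
have [hi ny] := kidP v yr.
case: (eqVneq (rank_of gp s y) 0) => i0.
  move: pv; rewrite /par /slot_parent i0 /= => gv.
  rewrite gv i0 in hi ny; rewrite /x1.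
  by case: (kids gp s v) hi ny => //= a l _ ->; rewrite eqxx.
have [q [qr gq rq pq]] := slot_parentP yr i0; rewrite pv in pq.
case: ifP pq => oi => [|vq]; last first.
  rewrite /x2 vq gq rq ifN; last by lia.
  have -> : 2 * (rank_of gp s y)./2 = rank_of gp s y by lia.
  by rewrite -vq ny eqxx orbT.
have ei : (2 * (rank_of gp s y)./2).+1 = rank_of gp s y by lia.
move=> vh; case: (eqVneq v q) => [vq|nq].
  rewrite /x1; case E: (kids gp s v) => [|z l].
    by rewrite vq gq rq ei -vq ny eqxx.
  rewrite vq in E; rewrite E /= in vh.
  have : z \in kids gp s q by rewrite E mem_head.
  rewrite mem_kids mem_s -vh vq => /andP [/eqP gqq _].
  by have := gp_dec qr; rewrite gqq ltnn.
have [_ gv rv] := head_kids (esym vh) nq.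
by rewrite /x2 rv /= gv gq rq ei ny eqxx orbT.
Qed.

Lemma slot_tree_binary : is_binary_tree H r.
Proof.
have [phi dec] := slot_parent_dec; split; first exact: parent_graph_tree dec.
by move=> v; rewrite (parent_graph_children v dec) slot_fiber.
Qed.

(** Go to the sibling [q] of half the rank by induction, then along one edge, or along two through
    the first child of [q] if the rank is odd. *)
Lemma slot_dist y : y != r -> dist H (gp y) y <= slot_depth (rank_of gp s y).
Proof.
have [phi dec] := slot_parent_dec.
have cH : connected_graph H := parent_graph_connected dec.
have step z : z != r -> dist H (par z) z <= 1.
  by move=> zr; apply/dist_le/walk_edge; rewrite /H /parent_graph zr eqxx orbT.
have [k] := ubnP (rank_of gp s y); elim: k y => // k IH y hk yr.
case: (eqVneq (rank_of gp s y) 0) => i0.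
  by have := step y yr; rewrite /par /slot_parent i0.
have [q [qr gq rq pq]] := slot_parentP yr i0.
rewrite slot_depthE ?lt0n // -rq -gq.
have := dist_triangle (gp q) q y cH; have := IH q _ qr; rewrite rq.
have ltk : (rank_of gp s y)./2 < k by lia.
move=> /(_ ltk); suff : dist H q y <= (odd (rank_of gp s y)).+1 by lia.
have := step y yr; rewrite pq; case: ifP => // oi.
case: (eqVneq (head q (kids gp s q)) q) => [->|nq]; first by lia.
have [hr gh rh] := head_kids (erefl _) nq.
have := step _ hr; rewrite {1}/par /slot_parent rh /= gh => h1 h2.
exact: leq_trans (dist_triangle q _ y cH) (leq_add h1 h2).
Qed.

Lemma kids_dist_sum p :
  \sum_(y | (y != r) && (gp y == p)) dist H p y <= slot_sum (size (kids gp s p)).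
Proof.
have -> : \sum_(y | (y != r) && (gp y == p)) dist H p y =
          \sum_(y <- kids gp s p) dist H p y.
  rewrite big_uniq ?uniq_kids //; apply: eq_bigl => y.
  by rewrite mem_kids mem_s andbC.
rewrite (big_nth p) big_mkord /slot_sum; apply: leq_sum => i _.
have hi := ltn_ord i; have := mem_nth p hi; set y := nth _ _ _.
rewrite mem_kids mem_s => /andP [/eqP gy yr].
by have := slot_dist yr; rewrite gy rank_nth.
Qed.

End SlotTree.

(** * Comparison of the cost of [H] with that of an arbitrary binary tree *)

Lemma sum_nbrs (T : finType) (e : rel T) r (F : T -> nat) u : is_tree e ->
  \sum_(v in nbrs e u) F v =
  \sum_(v | (v != r) && (gparent e r v == u)) F v +
  (if u != r then F (gparent e r u) else 0).
Proof.
move=> te; have [se ie _ ce _] := te.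
have gpr v : v != r -> dist e r (gparent e r v) < dist e r v.
  by move=> vr; have [_ ->] := gparentP ce vr.
case: (eqVneq u r) => ur /=.
  rewrite addn0; apply: eq_bigl => v; rewrite inE (gparent_edge r u v te).
  by rewrite ur eqxx.
rewrite addnC (bigD1 (gparent e r u)) /=; last first.
  by rewrite inE (gparent_edge r u _ te) ur eqxx.
congr addn; apply: eq_bigl => v; rewrite inE (gparent_edge r u v te) ur /=.
rewrite eq_sym; case: eqVneq => //= [->|_]; rewrite ?andbF ?andbT //.
apply/esym/negP => /andP [nr /eqP gg].
by have := gpr _ ur; have := gpr _ nr; rewrite gg; lia.
Qed.

Lemma cost_double n (g h : rel 'I_n) : is_tree g -> is_tree h ->
  2 * cost g h = \sum_u \sum_(v in nbrs g u) dist h u v.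
Proof.
move=> [sg ig _ _ _] [sh _ _ ch _].
rewrite pair_big_dep /= (bigID (fun p : 'I_n * 'I_n => p.1 < p.2)) /= mul2n -addnn.
congr addn; first by apply: eq_bigl => p; rewrite inE andbC.
rewrite (reindex_inj (inv_inj (_ : involutive (fun p : 'I_n * 'I_n => (p.2, p.1))))) /=.
  apply: eq_big => [p|p _]; last exact: dist_sym.
  rewrite inE sg andbC -leqNgt; case gp: (g _ _) => //=.
  by rewrite ltn_neqAle; case: eqP => // /val_inj e; rewrite e ig in gp.
by case.
Qed.

Lemma slot_tree_cost n (G : rel 'I_n) (r : 'I_n) (s : seq 'I_n) :
  is_tree G -> uniq s -> (forall y, (y \in s) = (y != r)) ->
  let H := parent_graph r (slot_parent (gparent G r) s) in
  is_binary_tree H r /\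
  forall h r', is_binary_tree h r' -> cost G H <= 4 * cost G h.
Proof.
move=> tG us ms H; set gp := gparent G r.
have [sG iG _ cG _] := tG.
have dec v : v != r -> dist G r (gp v) < dist G r v.
  by move=> vr; have [_ ->] := gparentP cG vr.
have bH : is_binary_tree H r := slot_tree_binary dec us ms.
split=> // h r' bh; have [[sH _ _ cH _] _] := bH.
have nk u : size (kids gp s u) = \sum_(v | (v != r) && (gp v == u)) 1.
  rewrite -sum1_size big_uniq ?uniq_kids //; apply: eq_bigl => y.
  by rewrite mem_kids ms andbC.
have sumk : \sum_u size (kids gp s u) = \sum_(u | u != r) 1.
  by rewrite [RHS](partition_big gp predT) //=; apply: eq_bigr => u _.
(* Each edge is seen once from its parent end and once from its child end; regrouped by parent, both
   halves are bounded by the same sum. *)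
have up : 2 * cost G H <= 2 * \sum_u slot_sum (size (kids gp s u)).
  rewrite (cost_double tG (proj1 bH)).
  under eq_bigr do rewrite (sum_nbrs r _ _ tG).
  rewrite big_split /= mul2n -addnn; apply: leq_add.
    by apply: leq_sum => u _; apply: (kids_dist_sum dec us ms).
  rewrite -big_mkcond /= (partition_big gp predT) //=; apply: leq_sum => u _.
  apply: leq_trans (kids_dist_sum dec us ms u); rewrite leq_eqVlt.
  apply/orP; left; apply/eqP; apply: eq_bigr => v /andP [_ /eqP gv].
  by rewrite dist_sym // -/gp gv.
(* The parent is one more neighbor of every vertex but the root. The resulting total of [n - 1]
   equals the number of all children and pays for the linear term of [slot_sum_le]. *)
have low : \sum_u (cubic_sum (size (kids gp s u)) + (u != r)) <= 2 * cost G h.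
  rewrite (cost_double tG (proj1 bh)); apply: leq_sum => u _.
  apply: (@leq_trans (cubic_sum #|nbrs G u|)); last first.
    by apply: (cubic_sum_nbrs bh); rewrite inE iG.
  rewrite -sum1_card (sum_nbrs r _ _ tG) -nk.
  by case: (u != r); rewrite ?addn1 ?addn0 // -addn1 leq_cubic_sumS.
rewrite big_split /= in low.
have up2 : \sum_u slot_sum (size (kids gp s u)) <=
   2 * \sum_u cubic_sum (size (kids gp s u)) + 2 * \sum_u size (kids gp s u).
  by rewrite !big_distrr -big_split /=; apply: leq_sum => u _; apply: slot_sum_le.
have eqs : \sum_u nat_of_bool (u != r) = \sum_u size (kids gp s u).
  by rewrite sumk [RHS]big_mkcond; apply: eq_bigr => u _; case: (u != r).
rewrite eqs in low; move: (cost G H) (cost G h) up low up2 => a b.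
move: (\sum_u slot_sum _) (\sum_u cubic_sum _) (\sum_u size _) => x y z.
by lia.
Qed.

(** * The machine program *)

(** Precondition calculus for loop-free code, including absence of overflow; loops go through
    [runs_while] instead. *)
Fixpoint wp (W : nat) (c : cmd) (Q : state -> Prop) (s : state) : Prop :=
  match c with
  | Skip => Q s
  | Const x k => k <= W /\ Q (set_reg s x k)
  | Add x y z => regs s y + regs s z <= W /\ Q (set_reg s x (regs s y + regs s z))
  | Sub x y z => Q (set_reg s x (regs s y - regs s z))
  | Read x y => Q (set_reg s x (ram s (regs s y)))
  | Write x y => Q (set_ram s (regs s x) (regs s y))
  | Seq c1 c2 => wp W c1 (wp W c2 Q) s
  | If x c1 c2 => if regs s x != 0 then wp W c1 Q s else wp W c2 Q s
  | While _ _ => False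
  end.

Fixpoint max_steps (c : cmd) : nat :=
  match c with
  | Seq c1 c2 => max_steps c1 + max_steps c2
  | If _ c1 c2 => (maxn (max_steps c1) (max_steps c2)).+1
  | _ => 1
  end.

Definition runs (W : nat) (c : cmd) (T : nat) (Q : state -> Prop) (s : state) : Prop :=
  exists t s', [/\ exec W c s t s', t <= T & Q s'].

Lemma wp_runs W c Q s : wp W c Q s -> runs W c (max_steps c) Q s.
Proof.
elim: c Q s => [|x k|x y z|x y z|x y|x y|c1 IH1 c2 IH2|x c1 IH1 c2 IH2|x c _] Q s //=.
- by move=> q; exists 1, s; split=> //; constructor.
- by case=> kW q; exists 1, (set_reg s x k); split=> //; constructor.
- by case=> kW q; exists 1; eexists; split; [constructor| |apply: q].
- by move=> q; exists 1; eexists; split; [constructor| |apply: q].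
- by move=> q; exists 1; eexists; split; [constructor| |apply: q].
- by move=> q; exists 1; eexists; split; [constructor| |apply: q].
- case/IH1 => t1 [s1 [e1 h1 /IH2 [t2 [s2 [e2 h2 q]]]]].
  by exists (t1 + t2), s2; split=> //; [apply: ExecSeq e2|apply: leq_add].
- case: ifP => [nz /IH1|/negbFE/eqP z /IH2] [t [s1 [e h q]]]; exists t.+1, s1.
    by split=> //; [apply: ExecIfTrue|rewrite ltnS leq_max h].
  by split=> //; [apply: ExecIfFalse|rewrite ltnS leq_max h orbT].
Qed.

Lemma runs_seq W c1 c2 T1 T2 Q s :
  runs W c1 T1 (runs W c2 T2 Q) s -> runs W (Seq c1 c2) (T1 + T2) Q s.
Proof.
case=> t1 [s1 [e1 h1 [t2 [s2 [e2 h2 q]]]]].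
by exists (t1 + t2), s2; split=> //; [apply: ExecSeq e2|apply: leq_add].
Qed.

Lemma runs_mono W c T (Q Q' : state -> Prop) s :
  runs W c T Q s -> (forall s', Q s' -> Q' s') -> runs W c T Q' s.
Proof. by case=> t [s' [e h q]] QQ; exists t, s'; split=> //; apply: QQ. Qed.

(** The index of the invariant is a measure that drops in every round, so there are at most [m]
    rounds of a test and a body, followed by one failing test. *)
Lemma runs_while W x c B (I : nat -> state -> Prop) m s :
  (forall k s', I k s' -> regs s' x != 0 ->
     runs W c B (fun s'' => exists2 j, j < k & I j s'') s') ->
  I m s ->
  runs W (While x c) (B.+1 * m).+1
    (fun s' => regs s' x = 0 /\ exists j, I j s') s.
Proof.
move=> step; elim/ltn_ind: m s => m IH s Im.
case: (eqVneq (regs s x) 0) => x0.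
  exists 1, s; split=> //; last by split=> //; exists m.
  exact: ExecWhileFalse.
have [t1 [s1 [e1 h1 [j jm Ij]]]] := step _ _ Im x0.
have [t2 [s2 [e2 h2 q]]] := IH j jm _ Ij.
exists (t1 + t2).+1, s2; split=> //; first exact: ExecWhileTrue e2.
apply: (@leq_trans (B + (B.+1 * j).+1).+1); first by rewrite ltnS leq_add.
by have := leq_mul (leqnn B.+1) jm; rewrite mulnS; lia.
Qed.

(* Register j holds j * n for j <= 8.  For 2 <= j <= 8 the cells j * n + v form an
   array indexed by the vertices v:
   2 - the number of remaining neighbors of v, which is set to 0 when v is pruned
       and is 2 too large at the root, so that the root is never pruned;
   3 - the sum modulo n of the neighbors of v, without the pruned children;
   4 - 0 if no child of v is pruned yet, otherwise 1 or 2 as their number is odd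
       or even;
   5 - the first pruned child c_0 of v;
   6 - the child c_(k/2) of v, where k is the number of its pruned children;
   7 - the last pruned child of v;
   8 - the next sibling of v. *)
Local Notation one_reg := 9 (only parsing).
Local Notation tmp_reg := 10 (only parsing).
Local Notation count_reg := 11 (only parsing).
Local Notation addr_reg := 12 (only parsing).
Local Notation node_reg := 13 (only parsing).
Local Notation parent_reg := 14 (only parsing).
Local Notation slot_reg := 15 (only parsing).
Local Notation last_reg := 16 (only parsing).
Local Notation aux_reg := 17 (only parsing).
Local Notation aux_reg2 := 18 (only parsing).
Local Notation mode_reg := 19 (only parsing).
Local Notation first_reg := 20 (only parsing).
Local Notation out_reg := 21 (only parsing).
Local Notation next_reg := 22 (only parsing).
Local Notation slot_mode_reg := 23 (only parsing).

Local Notation "c1 ;; c2" := (Seq c1 c2) (at level 60, right associativity).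

Definition load (z j i : nat) : cmd := Add tmp_reg j i ;; Read z tmp_reg.
Definition store (j i z : nat) : cmd := Add tmp_reg j i ;; Write tmp_reg z.

(* Reduces modulo n a register that is below 2 * n. *)
Definition reduce (z : nat) : cmd :=
  Sub tmp_reg 1 one_reg ;; Sub tmp_reg z tmp_reg ;; If tmp_reg (Sub z z 1) Skip.

(** Register 0 keeps the value 0, so the [store] hits the cell of the root, vertex 0. The edges
    start at address 1, and a tree has [n - 1] of them. *)
Definition prologue : cmd :=
  Read 1 0 ;; Const one_reg 1 ;;
  Add 2 1 1 ;; Add 3 2 1 ;; Add 4 3 1 ;; Add 5 4 1 ;;
  Add 6 5 1 ;; Add 7 6 1 ;; Add 8 7 1 ;;
  Const aux_reg 2 ;; store 2 0 aux_reg ;; Const addr_reg 1 ;; Sub count_reg 1 one_reg.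

Definition add_neighbor (u v : nat) : cmd :=
  load aux_reg 2 u ;; Add aux_reg aux_reg one_reg ;; store 2 u aux_reg ;;
  load aux_reg 3 u ;; Add aux_reg aux_reg v ;; reduce aux_reg ;; store 3 u aux_reg.

Definition read_edge : cmd :=
  Read node_reg addr_reg ;; Add addr_reg addr_reg one_reg ;;
  Read parent_reg addr_reg ;; Add addr_reg addr_reg one_reg ;;
  add_neighbor node_reg parent_reg ;; add_neighbor parent_reg node_reg ;;
  Sub count_reg count_reg one_reg.

(* A first child is linked to itself, until its next sibling overwrites the link.
   The link is stored before the next sibling is read because the slot register may
   hold the last child. *)
Definition prune_load : cmd :=
  load parent_reg 3 node_reg ;; load mode_reg 4 parent_reg ;;
  load last_reg 7 parent_reg ;; load slot_reg 6 parent_reg ;;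
  If mode_reg Skip (Add last_reg node_reg 0) ;; store 8 last_reg node_reg ;;
  load next_reg 8 slot_reg ;; load first_reg 5 parent_reg ;; load out_reg 5 slot_reg ;; load slot_mode_reg 4 slot_reg.

(** An even positive number [k] of earlier children puts the new child below [c_(k/2)] and keeps the
    pointer, as [(k+1)/2 = k/2]. An odd [k] puts it below the first child of [c_(k/2)], already in
    [out_reg] if there is one, and moves the pointer on. *)
Definition prune_choose : cmd :=
  If mode_reg
    (Sub aux_reg mode_reg one_reg ;;
     If aux_reg
       (Add out_reg slot_reg 0 ;; Const mode_reg 1)
       (If slot_mode_reg Skip (Add out_reg slot_reg 0) ;; Const mode_reg 2 ;;
        Add slot_reg next_reg 0))
    (Add out_reg parent_reg 0 ;; Const mode_reg 1 ;;
     Add slot_reg node_reg 0 ;; Add first_reg node_reg 0).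

(** The output cell [v + 1] may overwrite the edge list, which has been read by now. Adding [n]
    before subtracting [v] keeps the truncated subtraction exact. The parent is visited next, as it
    may have become a leaf. *)
Definition prune_store : cmd :=
  store 4 parent_reg mode_reg ;; store 5 parent_reg first_reg ;;
  store 6 parent_reg slot_reg ;; store 7 parent_reg node_reg ;;
  Add tmp_reg node_reg one_reg ;; Write tmp_reg out_reg ;;
  Const aux_reg 0 ;; store 2 node_reg aux_reg ;;
  load aux_reg 2 parent_reg ;; Sub aux_reg aux_reg one_reg ;; store 2 parent_reg aux_reg ;;
  load aux_reg 3 parent_reg ;; Add aux_reg aux_reg 1 ;; Sub aux_reg aux_reg node_reg ;;
  reduce aux_reg ;; store 3 parent_reg aux_reg ;;
  Add node_reg parent_reg 0.

Definition prune : cmd := prune_load ;; prune_choose ;; prune_store.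

(** The scan position is recovered as [n - count_reg], since pruning may have moved [node_reg] up a
    chain of parents. *)
Definition advance : cmd := Sub count_reg count_reg one_reg ;; Sub node_reg 1 count_reg.

(* The auxiliary register ends up 0 exactly if the degree is 1. *)
Definition visit : cmd :=
  load aux_reg 2 node_reg ;; Sub aux_reg2 aux_reg one_reg ;; Sub aux_reg one_reg aux_reg ;;
  Add aux_reg aux_reg aux_reg2 ;; If aux_reg advance prune.

(** Every visit either advances the scan or prunes a vertex, whence linear time. The last
    instruction replaces [n] in cell 0 by the root 0. *)
Definition program : cmd :=
  prologue ;; While count_reg read_edge ;;
  (Add count_reg 1 0 ;; Const node_reg 0) ;; While count_reg visit ;;
  Write 0 0.

(** * Execution rules for single instructions and array accesses *)

Definition upd (M : nat -> nat) (a v : nat) : nat -> nat := [eta M with a |-> v].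

Definition based (n : nat) (s : state) : Prop :=
  (forall j, j < 9 -> regs s j = j * n) /\ regs s one_reg = 1.

Lemma based_set n s z v : based n s -> 9 < z -> based n (set_reg s z v).
Proof.
move=> [bs b1] hz; split=> [j hj|] /=; rewrite ifN; try lia; exact: bs.
Qed.

Lemma wp_seq W c1 c2 Q s : wp W c1 (wp W c2 Q) s -> wp W (c1 ;; c2) Q s.
Proof. by []. Qed.

Lemma wp_if {W z c1 c2 Q s v} : regs s z = v ->
  (v != 0 -> wp W c1 Q s) -> (v = 0 -> wp W c2 Q s) -> wp W (If z c1 c2) Q s.
Proof. by move=> <- h1 h2 /=; case: eqP => /= [/h2|/eqP/h1]. Qed.

(** This rule and the following ones share a frame condition that exempts [tmp_reg], which array
    accesses and [reduce] overwrite; one tactic can then chain them all. *)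
Lemma wp_const {n W z v Q s} : based n s -> 9 < z -> v <= W ->
  (forall s', based n s' -> ram s' = ram s -> regs s' z = v ->
     (forall k, k \notin [:: z; tmp_reg] -> regs s' k = regs s k) -> Q s') ->
  wp W (Const z v) Q s.
Proof.
move=> bs hz hv hQ; split=> //; apply: hQ => //=; first exact: based_set.
- by rewrite eqxx.
by move=> k; rewrite !inE negb_or => /andP [/negPf ->].
Qed.

Lemma wp_add {n W z i j a b Q s} : based n s -> 9 < z ->
  regs s i = a -> regs s j = b -> a + b <= W ->
  (forall s', based n s' -> ram s' = ram s -> regs s' z = a + b ->
     (forall k, k \notin [:: z; tmp_reg] -> regs s' k = regs s k) -> Q s') ->
  wp W (Add z i j) Q s.
Proof.
move=> bs hz <- <- hv hQ; split=> //; apply: hQ => //=; first exact: based_set.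
- by rewrite eqxx.
by move=> k; rewrite !inE negb_or => /andP [/negPf ->].
Qed.

Lemma wp_sub {n W z i j a b Q s} : based n s -> 9 < z ->
  regs s i = a -> regs s j = b ->
  (forall s', based n s' -> ram s' = ram s -> regs s' z = a - b ->
     (forall k, k \notin [:: z; tmp_reg] -> regs s' k = regs s k) -> Q s') ->
  wp W (Defs.Sub z i j) Q s.
Proof.
move=> bs hz <- <- hQ /=; apply: hQ => //=; first exact: based_set.
- by rewrite eqxx.
by move=> k; rewrite !inE negb_or => /andP [/negPf ->].
Qed.

Lemma wp_read {n W z i a Q s} : based n s -> 9 < z -> regs s i = a ->
  (forall s', based n s' -> ram s' = ram s -> regs s' z = ram s a ->
     (forall k, k \notin [:: z; tmp_reg] -> regs s' k = regs s k) -> Q s') ->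
  wp W (Read z i) Q s.
Proof.
move=> bs hz <- hQ /=; apply: hQ => //=; first exact: based_set.
- by rewrite eqxx.
by move=> k; rewrite !inE negb_or => /andP [/negPf ->].
Qed.

Lemma wp_write {n W i z a b Q s} : based n s -> regs s i = a -> regs s z = b ->
  (forall s', based n s' -> ram s' = upd (ram s) a b ->
     (forall k, k \notin [:: tmp_reg; tmp_reg] -> regs s' k = regs s k) -> Q s') ->
  wp W (Write i z) Q s.
Proof. by move=> bs <- <- hQ; apply: hQ. Qed.

Lemma wp_load {n W z j i a Q s} : based n s -> 9 * n <= W -> j < 9 -> 9 < z ->
  regs s i = a -> a < n ->
  (forall s', based n s' -> ram s' = ram s ->
     regs s' z = ram s (j * n + a) ->
     (forall k, k \notin [:: z; tmp_reg] -> regs s' k = regs s k) -> Q s') ->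
  wp W (load z j i) Q s.
Proof.
move=> bs hW hj hz ia han hQ; apply: wp_seq; apply: (wp_add bs _ (proj1 bs j hj) ia) => //.
  by have := leq_mul hj (leqnn n); lia.
move=> s1 b1 M1 t1 k1; apply: (wp_read b1 hz t1) => s2 b2 M2 z2 k2.
apply: hQ; rewrite -?M1 // => k hk.
by rewrite k2 // k1 //; move: hk; rewrite !inE; lia.
Qed.

Lemma wp_store {n W j i z a v Q s} : based n s -> 9 * n <= W -> j < 9 ->
  regs s i = a -> a < n -> regs s z = v -> z != tmp_reg ->
  (forall s', based n s' -> ram s' = upd (ram s) (j * n + a) v ->
     (forall k, k \notin [:: tmp_reg; tmp_reg] -> regs s' k = regs s k) -> Q s') ->
  wp W (store j i z) Q s.
Proof.
move=> bs hW hj ia han zv hz hQ; apply: wp_seq.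
apply: (wp_add bs _ (proj1 bs j hj) ia) => //.
  by have := leq_mul hj (leqnn n); lia.
move=> s1 b1 M1 t1 k1; apply: (wp_write b1 t1 (erefl _)) => s2 b2 M2 k2.
have kz : regs s1 z = v by rewrite k1 // !inE negb_or hz.
by apply: hQ; rewrite -?M1 -?kz // => k hk; rewrite k2 ?k1.
Qed.

Lemma wp_reduce {n W z v Q s} : based n s -> 9 < z -> z != tmp_reg -> 0 < n ->
  regs s z = v -> v < 2 * n ->
  (forall s', based n s' -> ram s' = ram s -> regs s' z = v %% n ->
     (forall k, k \notin [:: z; tmp_reg] -> regs s' k = regs s k) -> Q s') ->
  wp W (reduce z) Q s.
Proof.
move=> bs hz zt n0 zv hv hQ; have [bj b1] := bs.
apply: wp_seq; apply: (wp_sub bs _ (bj 1 isT) b1) => // s1 bs1 M1 t1 k1.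
have z1 : regs s1 z = v by rewrite k1 // !inE negb_or zt.
apply: wp_seq; apply: (wp_sub bs1 _ z1 t1) => // s2 bs2 M2 t2 k2.
have keep k : k \notin [:: z; tmp_reg] -> regs s2 k = regs s k.
  rewrite !inE negb_or => /andP [_ kt].
  by rewrite k2 ?k1 // !inE negb_or kt.
have z2 : regs s2 z = v by rewrite k2 // !inE negb_or zt.
apply: (wp_if t2) => h.
  apply: (wp_sub bs2 _ z2 (proj1 bs2 1 isT)) => // s3 bs3 M3 z3 k3.
  apply: hQ => //; rewrite ?M3 ?M2 //; last by move=> k hk; rewrite k3 ?keep.
  rewrite z3 mul1n; have {2}-> : v = (v - n) + n by lia.
  by rewrite modnDr modn_small; lia.
by apply: hQ; rewrite ?M2 ?M1 // z2 modn_small //; lia.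
Qed.

Ltac carry s s' :=
  match goal with K : forall k, _ -> regs s' k = regs s k |- _ =>
    repeat match goal with H : regs s ?k = _ |- _ =>
      first [rewrite -(K k isT) in H | clear H] end;
    try clear K;
    repeat match goal with
      | B : based _ s |- _ => clear B
      | M : ram s = _, M' : context [ram s] |- _ => rewrite M in M'
      end
  end.

Ltac after s :=
  let s' := fresh "s" in
  move=> s'; intros; carry s s'; cbv beta.

Ltac step := lazymatch goal with
  | |- wp _ (_ ;; _) _ _ => apply: wp_seq; step
  | |- wp _ Skip ?Q ?s => change (Q s); step
  | B : based ?n ?s |- wp _ (load ?z ?j ?i) _ ?s =>
      apply: (wp_load B _ _ _); [by [] | by [] | by [] | by eassumption | | after s]
  | B : based ?n ?s |- wp _ (store ?j ?i ?z) _ ?s =>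
      apply: (wp_store B _ _); [by [] | by [] | by eassumption | | by eassumption | by [] | after s]
  | B : based ?n ?s |- wp _ (reduce ?z) _ ?s =>
      apply: (wp_reduce B); [by [] | by [] | by [] | by eassumption | | after s]
  | B : based ?n ?s |- wp _ (Add _ _ _) _ ?s =>
      apply: (wp_add B); [by [] | by eassumption | by eassumption | | after s]
  | B : based ?n ?s |- wp _ (Defs.Sub _ _ _) _ ?s =>
      apply: (wp_sub B); [by [] | by eassumption | by eassumption | after s]
  | B : based ?n ?s |- wp _ (Const _ _) _ ?s =>
      apply: (wp_const B); [by [] | | after s]
  | B : based ?n ?s |- wp _ (Read _ _) _ ?s =>
      apply: (wp_read B); [by [] | by eassumption | after s]
  | B : based ?n ?s |- wp _ (Write _ _) _ ?s =>
      apply: (wp_write B); [by eassumption | by eassumption | after s]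
  end.

(** * Symbolic execution of the two loop bodies *)

Lemma wp_prune_load n W M (wv cv : nat) (Q : state -> Prop) s :
  0 < n -> 9 * n <= W -> based n s -> ram s = M ->
  regs s node_reg = wv -> regs s count_reg = cv -> wv < n ->
  (forall j a, 2 < j < 9 -> j != 4 -> a < n -> M (j * n + a) < n) ->
  let pv := M (3 * n + wv) in
  let kv := M (4 * n + pv) in
  let qv := M (6 * n + pv) in
  let lv := if kv == 0 then wv else M (7 * n + pv) in
  let M1 := upd M (8 * n + lv) wv in
  (forall s', based n s' -> ram s' = M1 -> regs s' node_reg = wv -> regs s' count_reg = cv ->
    regs s' parent_reg = pv -> regs s' mode_reg = kv -> regs s' slot_reg = qv ->
    regs s' next_reg = M1 (8 * n + qv) -> regs s' first_reg = M1 (5 * n + pv) ->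
    regs s' out_reg = M1 (5 * n + qv) -> regs s' slot_mode_reg = M1 (4 * n + qv) -> Q s') ->
  wp W prune_load Q s.
Proof.
move=> n0 hW bs Ms hw hc wn hM pv kv qv lv M1 hQ.
have h0 : regs s 0 = 0 by rewrite (proj1 bs).
have pn : pv < n by apply: hM.
have qn : qv < n by apply: hM.
have ln : lv < n by rewrite /lv; case: ifP => _ //; apply: hM.
rewrite /prune_load; do 4 step => //.
have hm : regs s3 mode_reg = kv by [].
have hl : regs s3 last_reg = M (7 * n + pv) by [].
have rest s' : based n s' -> ram s' = M -> regs s' node_reg = wv -> regs s' count_reg = cv ->
    regs s' parent_reg = pv -> regs s' mode_reg = kv -> regs s' slot_reg = qv -> regs s' last_reg = lv ->
    wp W (store 8 last_reg node_reg ;; load next_reg 8 slot_reg ;; load first_reg 5 parent_reg ;; load out_reg 5 slot_reg ;;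
          load slot_mode_reg 4 slot_reg) Q s'.
  by move=> *; do 5 step => //; apply: hQ.
apply: wp_seq; apply: (wp_if hm) => hk.
  by apply: rest => //; rewrite hl /lv (negPf hk).
step; first lia.
by apply: rest => //; rewrite /lv hk -[RHS]addn0.
Qed.

(** The components are the parent in [H], the new mode, the new pointer and the first child; the
    branches stand for no, an odd number of, and a positive even number of earlier children. *)
Definition slot_choice (wv pv kv qv nq f fq qm : nat) : nat * nat * nat * nat :=
  if kv == 0 then (pv, 1, wv, wv) else
  if kv == 1 then (if qm == 0 then qv else fq, 2, nq, f) else (qv, 1, qv, f).

Lemma wp_prune_choose n W M wv cv pv kv qv nq f fq qm (Q : state -> Prop) s :
  0 < n -> 9 * n <= W -> based n s -> ram s = M ->
  regs s node_reg = wv -> regs s count_reg = cv -> regs s parent_reg = pv -> regs s mode_reg = kv ->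
  regs s slot_reg = qv -> regs s next_reg = nq -> regs s first_reg = f -> regs s out_reg = fq ->
  regs s slot_mode_reg = qm -> wv < n -> pv < n -> qv < n -> nq < n ->
  (forall s', based n s' -> ram s' = M -> regs s' node_reg = wv -> regs s' count_reg = cv ->
    regs s' parent_reg = pv ->
    (regs s' out_reg, regs s' mode_reg, regs s' slot_reg, regs s' first_reg) =
      slot_choice wv pv kv qv nq f fq qm -> Q s') ->
  wp W prune_choose Q s.
Proof.
move=> n0 hW bs Ms hw hc hp hm hq hn hf hfq hqm wn pn qn nn hQ.
have h0 : regs s 0 = 0 by rewrite (proj1 bs).
have h1 : regs s one_reg = 1 by case: bs.
rewrite /slot_choice in hQ; apply: (wp_if hm) => hk; last first.
  rewrite hk eqxx in hQ; do 4 (step; first lia).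
  by apply: hQ => //; congr (_, _, _, _); lia.
rewrite (negPf hk) in hQ.
step; have hx : regs s0 aux_reg = kv - 1 by [].
apply: (wp_if hx) => {}hx.
  have e : (kv == 1) = false by lia.
  rewrite e in hQ; do 2 (step; first lia).
  by apply: hQ => //; congr (_, _, _, _); lia.
have e : (kv == 1) = true by lia.
rewrite e in hQ; apply: wp_seq; have hqm' : regs s0 slot_mode_reg = qm by [].
apply: (wp_if hqm') => hz.
  rewrite (negPf hz) in hQ; do 2 (step; first lia).
  by apply: hQ => //; congr (_, _, _, _); lia.
rewrite hz eqxx in hQ; do 3 (step; first lia).
by apply: hQ => //; congr (_, _, _, _); lia.
Qed.

Definition prune_memory (n : nat) (M : nat -> nat) (wv pv : nat)
    (c : nat * nat * nat * nat) : nat -> nat :=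
  let: (par', mode', ptr', first') := c in
  let M1 := upd (upd (upd (upd M (4 * n + pv) mode') (5 * n + pv) first')
    (6 * n + pv) ptr') (7 * n + pv) wv in
  let M2 := upd (upd M1 (wv + 1) par') (2 * n + wv) 0 in
  let M3 := upd M2 (2 * n + pv) (M2 (2 * n + pv) - 1) in
  upd M3 (3 * n + pv) ((M3 (3 * n + pv) + n - wv) %% n).

Lemma cell_neq n i j a b : a < n -> b < n -> i != j ->
  (i * n + a == j * n + b) = false.
Proof.
move=> an bn; rewrite neq_ltn => /orP [] ij; have := leq_mul ij (leqnn n);
  by rewrite mulSn; lia.
Qed.

Lemma cell_out_neq n j a b : b < n -> 1 < j -> (j * n + a == b + 1) = false.
Proof. by move=> bn j1; have := leq_mul j1 (leqnn n); lia. Qed.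

Lemma wp_prune_store n W M wv cv pv c (Q : state -> Prop) s :
  0 < n -> 9 * n <= W -> based n s -> ram s = M ->
  regs s node_reg = wv -> regs s count_reg = cv -> regs s parent_reg = pv ->
  (regs s out_reg, regs s mode_reg, regs s slot_reg, regs s first_reg) = c ->
  wv < n -> pv < n -> M (3 * n + pv) < n ->
  (forall s', based n s' -> ram s' = prune_memory n M wv pv c ->
     regs s' node_reg = pv -> regs s' count_reg = cv -> Q s') ->
  wp W prune_store Q s.
Proof.
case: c => -[[par' mode'] ptr'] first'.
move=> n0 hW bs Ms hw hc hp [hpar hmode hptr hfirst] wn pn sn hQ.
have h0 : regs s 0 = 0 by rewrite (proj1 bs).
have h1 : regs s one_reg = 1 by case: bs.
have hn : regs s 1 = n by rewrite (proj1 bs) // mul1n.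
rewrite /prune_store; do 4 (step; first by []).
step; first lia.
step.
step; first lia.
do 2 (step; first by []).
step.
do 2 (step; first by []).
step; first by rewrite /upd /= !(cell_neq, cell_out_neq) //; lia.
step.
step; first by rewrite /upd /= !(cell_neq, cell_out_neq) //; lia.
step; first by [].
step; first lia.
by apply: hQ => //; rewrite -[RHS]addn0.
Qed.

Definition prune_step (n : nat) (M : nat -> nat) (wv : nat) : nat -> nat :=
  let pv := M (3 * n + wv) in
  let kv := M (4 * n + pv) in
  let qv := M (6 * n + pv) in
  let M1 := upd M (8 * n + (if kv == 0 then wv else M (7 * n + pv))) wv in
  prune_memory n M1 wv pv
    (slot_choice wv pv kv qv (M1 (8 * n + qv)) (M1 (5 * n + pv)) (M1 (5 * n + qv))
       (M1 (4 * n + qv))).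

Lemma wp_prune n W M (wv cv : nat) (Q : state -> Prop) s :
  0 < n -> 9 * n <= W -> based n s -> ram s = M ->
  regs s node_reg = wv -> regs s count_reg = cv -> wv < n ->
  (forall j a, 2 < j < 9 -> j != 4 -> a < n -> M (j * n + a) < n) ->
  (forall s', based n s' -> ram s' = prune_step n M wv ->
     regs s' node_reg = M (3 * n + wv) -> regs s' count_reg = cv -> Q s') ->
  wp W prune Q s.
Proof.
move=> n0 hW bs Ms hw hc wn hM hQ.
have pn : M (3 * n + wv) < n by apply: hM.
have qn : M (6 * n + M (3 * n + wv)) < n by apply: hM.
apply: wp_seq; apply: (wp_prune_load n0 hW bs Ms hw hc wn hM).
move=> s1 bs1 Ms1 hw1 hc1 hp1 hm1 hq1 hn1 hf1 hr1 hqm1; apply: wp_seq.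
have upd_lt a b : M b < n -> upd M a wv b < n by rewrite /upd /=; case: ifP.
apply: (wp_prune_choose n0 hW bs1 Ms1 hw1 hc1 hp1 hm1 hq1 hn1 hf1 hr1 hqm1 wn pn qn).
  by apply/upd_lt/hM.
move=> s2 bs2 Ms2 hw2 hc2 hp2 hch.
apply: (wp_prune_store n0 hW bs2 Ms2 hw2 hc2 hp2 hch wn pn _ hQ).
by apply/upd_lt/hM.
Qed.

Lemma wp_visit n W M (wv cv : nat) (Q : state -> Prop) s :
  0 < n -> 9 * n <= W -> based n s -> ram s = M ->
  regs s node_reg = wv -> regs s count_reg = cv -> wv < n ->
  (forall j a, 2 < j < 9 -> j != 4 -> a < n -> M (j * n + a) < n) ->
  M (2 * n + wv) <= 2 * n ->
  (M (2 * n + wv) <> 1 -> forall s', based n s' -> ram s' = M ->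
     regs s' node_reg = n - (cv - 1) -> regs s' count_reg = cv - 1 -> Q s') ->
  (M (2 * n + wv) = 1 -> forall s', based n s' -> ram s' = prune_step n M wv ->
     regs s' node_reg = M (3 * n + wv) -> regs s' count_reg = cv -> Q s') ->
  wp W visit Q s.
Proof.
move=> n0 hW bs Ms hw hc wn hM hd hne heq.
have h1 : regs s one_reg = 1 by case: bs.
have hn : regs s 1 = n by rewrite (proj1 bs) // mul1n.
rewrite /visit; step; first by [].
step.
step.
step; first lia.
have hx : regs s3 aux_reg = (1 - M (2 * n + wv)) + (M (2 * n + wv) - 1) by [].
apply: (wp_if hx) => {}hx.
  by rewrite /advance; do 2 step; apply: hne => //; lia.
by apply: (wp_prune n0 hW (M := M) (wv := wv) (cv := cv)) => // *; apply: heq => //; lia.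
Qed.

Definition edge_memory (n : nat) (M : nat -> nat) (a b : nat) : nat -> nat :=
  let M1 := upd M (2 * n + a) (M (2 * n + a) + 1) in
  upd M1 (3 * n + a) ((M1 (3 * n + a) + b) %% n).

Lemma edge_memory2 n M a b i : a < n -> i < n ->
  edge_memory n M a b (2 * n + i) = (i == a) + M (2 * n + i).
Proof.
move=> an hi; rewrite /edge_memory /upd /= cell_neq // eqn_add2l.
by case: eqP => // ->; rewrite addnC.
Qed.

Lemma edge_memory3 n M a b i : a < n -> i < n ->
  edge_memory n M a b (3 * n + i) =
  if i == a then (M (3 * n + a) + b) %% n else M (3 * n + i).
Proof. by move=> an hi; rewrite /edge_memory /upd /= eqn_add2l !cell_neq. Qed.

Lemma edge_memory_neq n M a b c : c != 2 * n + a -> c != 3 * n + a ->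
  edge_memory n M a b c = M c.
Proof. by move=> c2 c3; rewrite /edge_memory /upd /= (negPf c2) (negPf c3). Qed.

Lemma wp_read_edge n W M (av cv a b : nat) (Q : state -> Prop) s :
  0 < n -> 9 * n <= W -> based n s -> ram s = M ->
  regs s addr_reg = av -> regs s count_reg = cv -> M av = a -> M (av + 1) = b ->
  a < n -> b < n -> av + 2 <= W ->
  (forall i, i < n -> M (2 * n + i) + 2 <= W) ->
  (forall i, i < n -> M (3 * n + i) < n) ->
  (forall s', based n s' -> ram s' = edge_memory n (edge_memory n M a b) b a ->
     regs s' addr_reg = av + 2 -> regs s' count_reg = cv - 1 -> Q s') ->
  wp W read_edge Q s.
Proof.
move=> n0 hW bs Ms ha hc Ma Mb an bn hav hd hS hQ.
have h1 : regs s one_reg = 1 by case: bs.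
rewrite /read_edge /add_neighbor; step.
step; first lia.
step.
step; first lia.
have hu : regs s3 node_reg = a by rewrite -Ma.
have hv : regs s3 parent_reg = b by rewrite -Mb.
have had : regs s3 addr_reg = av + 2 by lia.
repeat match goal with
  | H : regs _ _ = M _ |- _ => clear H
  | H : regs _ _ = av + 1 + 1 |- _ => clear H
  end.
apply: wp_seq; step; first by [].
step; first by have := hd a an; lia.
step; first by [].
step; first by [].
step; first by rewrite {1}/upd /= cell_neq //; have := hS a an; lia.
step; first by rewrite {1}/upd /= cell_neq //; have := hS a an; lia.
step; first by [].
have S' : edge_memory n M a b (3 * n + b) < n.
  by rewrite edge_memory3 //; case: ifP => _; [rewrite ltn_mod|apply: hS].
have d' : edge_memory n M a b (2 * n + b) + 1 <= W.
  by rewrite edge_memory2 //; have := hd b bn; case: eqP => /=; lia.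
have skip E d : upd E (2 * n + b) d (3 * n + b) = E (3 * n + b).
  by rewrite /upd /= cell_neq.
apply: wp_seq; step; first by [].
step; first exact: d'.
step; first by [].
step; first by [].
step; first by rewrite skip; move: S'; rewrite /edge_memory; lia.
step; first by rewrite skip; move: S'; rewrite /edge_memory; lia.
step; first by [].
step.
exact: hQ.
Qed.

Lemma wp_prologue n W M (Q : state -> Prop) : 0 < n -> 9 * n <= W -> M 0 = n ->
  (forall s', based n s' -> ram s' = upd M (2 * n + 0) 2 ->
     regs s' addr_reg = 1 -> regs s' count_reg = n - 1 -> Q s') ->
  wp W prologue Q (State (fun=> 0) M).
Proof.
move=> n0 hW M0 hQ; rewrite /= M0.
do 11 (split; first by lia).
apply: hQ => //=.
split=> //= j hj; do 9 (case: j hj => [|j] hj; first by rewrite /=; lia).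
by [].
by rewrite !addn0 mul2n -addnn.
Qed.

(** * Pruning a leaf *)

Lemma half_ltn k : k != 0 -> k./2 < k.
Proof. by lia. Qed.

(** Output cells never need correction: pruning [v] only appends to the list of [gp v], which is
    unpruned, so [y] and its half-rank sibling keep their ranks and the children of that sibling are
    complete. *)
Lemma slot_parent_rcons (T : finType) (gp : T -> T) s v y :
  y \in s -> gp v \notin s -> slot_parent gp (rcons s v) y = slot_parent gp s y.
Proof.
move=> ys gv; have yk : y \in kids gp s (gp y) by rewrite mem_kids eqxx.
have stable q : q \in s -> kids gp (rcons s v) q = kids gp s q.
  by move=> qs; rewrite kids_rcons; case: eqP => // e; rewrite e qs in gv.
have [t kt] : exists t, kids gp (rcons s v) (gp y) = kids gp s (gp y) ++ t.
  rewrite kids_rcons; case: eqP => _; last by exists [::]; rewrite cats0.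
  by exists [:: v]; rewrite cats1.
have rk : rank_of gp (rcons s v) y = rank_of gp s y.
  by rewrite /rank_of kt index_cat yk.
have hi : (rank_of gp s y)./2 < size (kids gp s (gp y)).
  have: rank_of gp s y < size (kids gp s (gp y)) by rewrite index_mem.
  by lia.
rewrite /slot_parent rk kt nth_cat hi stable //.
by have := mem_nth y hi; rewrite mem_kids => /andP [].
Qed.

Section PruneMemory.

Variables (n : nat) (M : nat -> nat) (v p par mode ptr first : nat).
Hypotheses (hv : v < n) (hp : p < n).
Let M' := prune_memory n M v p (par, mode, ptr, first).

Ltac cells := rewrite /M' /prune_memory /upd /= ?eqn_add2l;
  rewrite ?cell_neq ?cell_out_neq //.

Lemma prune_memory2 a : a < n -> M' (2 * n + a) =
  if a == p then (if p == v then 0 else M (2 * n + p)) - 1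
  else if a == v then 0 else M (2 * n + a).
Proof. by move=> ha; cells. Qed.

Lemma prune_memory3 a : a < n -> M' (3 * n + a) =
  if a == p then (M (3 * n + p) + n - v) %% n else M (3 * n + a).
Proof. by move=> ha; cells. Qed.

Lemma prune_memory4 a : a < n -> M' (4 * n + a) =
  if a == p then mode else M (4 * n + a).
Proof. by move=> ha; cells. Qed.

Lemma prune_memory5 a : a < n -> M' (5 * n + a) =
  if a == p then first else M (5 * n + a).
Proof. by move=> ha; cells. Qed.

Lemma prune_memory6 a : a < n -> M' (6 * n + a) =
  if a == p then ptr else M (6 * n + a).
Proof. by move=> ha; cells. Qed.

Lemma prune_memory7 a : a < n -> M' (7 * n + a) =
  if a == p then v else M (7 * n + a).
Proof. by move=> ha; cells. Qed.

Lemma prune_memory8 a : a < n -> M' (8 * n + a) = M (8 * n + a).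
Proof. by move=> ha; cells. Qed.

Lemma prune_memory_out a : a < n -> M' (a + 1) =
  if a == v then par else M (a + 1).
Proof.
move=> ha; rewrite /M' /prune_memory /upd /= ![(a + 1 == _)]eq_sym.
by rewrite !cell_out_neq // eqn_add2r eq_sym.
Qed.

End PruneMemory.

(** * The memory invariant of the pruning loop *)

Section Invariant.

Variables (n : nat) (G : rel 'I_n) (r : 'I_n).
Hypothesis tree_G : is_tree G.
Let gp := gparent G r.

(** Here [s] is the pruning order so far, in which a vertex comes after all its children. The bound
    makes every entry that holds a vertex a valid array index. *)
Record pruned (s : seq 'I_n) (M : nat -> nat) : Prop := Pruned {
  pruned_uniq : uniq s;
  pruned_root : r \notin s;
  pruned_closed : forall u, u != r -> gp u \in s -> u \in s;
  pruned_dead : forall u : 'I_n, u \in s -> M (2 * n + u) = 0;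
  pruned_deg : forall u : 'I_n, u \notin s ->
    M (2 * n + u) + size (kids gp s u) = #|nbrs G u| + 2 * (u == r);
  pruned_sum : forall u : 'I_n,
    M (3 * n + u) + \sum_(y <- kids gp s u) val y = \sum_(y in nbrs G u) val y %[mod n];
  pruned_bound : forall j a, 2 < j < 9 -> j != 4 -> a < n -> M (j * n + a) < n;
  pruned_mode : forall u : 'I_n, M (4 * n + u) =
    let k := size (kids gp s u) in if k == 0 then 0 else if odd k then 1 else 2;
  pruned_queue : forall u : 'I_n, let K := kids gp s u in 0 < size K ->
    [/\ M (5 * n + u) = head u K, M (6 * n + u) = nth u K (size K)./2 &
        M (7 * n + u) = last u K];
  pruned_next : forall (u : 'I_n) i, let K := kids gp s u in i.+1 < size K ->
    M (8 * n + nth u K i) = nth u K i.+1;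
  pruned_out : forall u : 'I_n, u \in s -> M (u + 1) = slot_parent gp s u
}.

Lemma gp_dec u : u != r -> dist G r (gp u) < dist G r u.
Proof. by case: tree_G => [_ _ _ cG _] /(gparentP cG) [_ ->]. Qed.

Lemma kids_sum s u (F : 'I_n -> nat) : uniq s ->
  \sum_(y <- kids gp s u) F y = \sum_(y | (y \in s) && (gp y == u)) F y.
Proof.
move=> us; rewrite big_uniq ?filter_uniq //; apply: eq_bigl => y.
by rewrite mem_kids andbC.
Qed.

(** The surplus 2 rules out the root. For any other vertex, the one remaining neighbor is the
    parent, so all children are pruned and the remaining sum modulo [n] is the parent itself. *)
Lemma pruned_leaf s M (u : 'I_n) : pruned s M -> M (2 * n + u) = 1 ->
  [/\ u \notin s, u != r, gp u \notin s, M (3 * n + u) = gp u &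
      forall y, y != r -> gp y = u -> y \in s].
Proof.
move=> I d1; have us : u \notin s.
  by apply/negP => /(pruned_dead I); rewrite d1.
have sub y : (y \in s) && (gp y == u) -> (y != r) && (gp y == u).
  case/andP => ys ->; rewrite andbT.
  by apply: contraNneq (pruned_root I) => <-.
have sk := kids_sum u (fun=> 1) (pruned_uniq I).
have deg := pruned_deg I us.
rewrite d1 -sum1_size sk -sum1_card (sum_nbrs r (fun=> 1) u tree_G) in deg.
have le : \sum_(y | (y \in s) && (gp y == u)) 1 <= \sum_(y | (y != r) && (gp y == u)) 1.
  by rewrite !sum1_card; apply: subset_leq_card; apply/subsetP => y; apply: sub.
have ur : u != r.
  apply/negP => /eqP ur; move: deg le; rewrite -/gp ur eqxx /=.
  by move: (\sum_(_ | _) _) (\sum_(_ | _) _) => a b; lia.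
have all_kids y : (y \in s) && (gp y == u) = (y != r) && (gp y == u).
  have eqc : #|[set y | (y \in s) && (gp y == u)]| =
             #|[set y | (y != r) && (gp y == u)]|.
    move: deg; rewrite -!sum1dep_card -/gp ur (negPf ur).
    by move: (\sum_(_ | _) _) (\sum_(_ | _) _) => a b; lia.
  have /eqP/setP/(_ y) : [set y | (y \in s) && (gp y == u)] ==
             [set y | (y != r) && (gp y == u)].
    rewrite eqEcard eqc leqnn andbT; apply/subsetP => z; rewrite !inE; exact: sub.
  by rewrite !inE.
split=> //; last first.
- by move=> y yr gy; have := all_kids y; rewrite yr gy eqxx andbT.
- have := pruned_sum I u; rewrite (kids_sum u (fun y => val y) (pruned_uniq I)).
  rewrite (sum_nbrs r (fun y => val y) u tree_G) ur -/gp (eq_bigl _ _ all_kids).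
  rewrite addnC => /eqP; rewrite eqn_modDl => /eqP.
  by rewrite (modn_small (ltn_ord _)) modn_small // (pruned_bound I).
by apply/negP => /(pruned_closed I ur); rewrite (negPf us).
Qed.

Lemma prune_pruned s M (u : 'I_n) : pruned s M -> M (2 * n + u) = 1 ->
  pruned (rcons s u) (prune_step n M u).
Proof.
move=> I d1; have [us ur gus gu kids_u] := pruned_leaf I d1.
have n0 : 0 < n by apply: leq_ltn_trans (ltn_ord u).
have gnu : gp u != u by apply: contraTneq (gp_dec ur) => ->; rewrite ltnn.
set p := gp u in gus gu gnu *; set K := kids gp s p.
have uK : uniq K := filter_uniq _ (pruned_uniq I).
have kidsE x : kids gp (rcons s u) x = if p == x then rcons K u else kids gp s x.
  by rewrite kids_rcons; case: eqP => // <-.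
have KS y : y \in K -> y \in s /\ gp y = p.
  by rewrite mem_kids => /andP [/eqP].
have uK' : u \notin K by apply/negP => /KS []; rewrite (negPf us).
pose k := size K.
have kvE : M (4 * n + p) = if k == 0 then 0 else if odd k then 1 else 2.
  exact: pruned_mode I p.
have kv0 : (M (4 * n + p) == 0) = (k == 0) by rewrite kvE; case: (k == 0) => //; case: odd.
have kv1 : (M (4 * n + p) == 1) = odd k.
  by rewrite kvE; case: (eqVneq k 0) => [->|_] //; case: odd.
pose l : 'I_n := if k == 0 then u else last p K.
have queueP x : size (kids gp s x) != 0 -> let K' := kids gp s x in
    [/\ M (5 * n + x) = head x K', M (6 * n + x) = nth x K' (size K')./2 &
        M (7 * n + x) = last x K'].
  by rewrite -lt0n; apply: (pruned_queue I).
have lE : (if M (4 * n + p) == 0 then val u else M (7 * n + p)) = l.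
  rewrite kv0 /l; case: eqVneq => // k0.
  by have [_ _ ->] := queueP p k0.
pose M1 := upd M (8 * n + l) u.
have M1E j a : a < n -> 1 < j -> j != 8 -> M1 (j * n + a) = M (j * n + a).
  by move=> *; rewrite /M1 /upd /= cell_neq.
have M1out a : a < n -> M1 (a + 1) = M (a + 1).
  by move=> *; rewrite /M1 /upd /= eq_sym cell_out_neq.
(* The only new link sits at [l], which is [u] or the last pruned child of [p], so the lists of
   other vertices keep their links. *)
have M1next (x : 'I_n) i : i.+1 < size (kids gp (rcons s u) x) ->
    M1 (8 * n + nth x (kids gp (rcons s u) x) i) =
    nth x (kids gp (rcons s u) x) i.+1.
  rewrite kidsE /M1 /upd /= eqn_add2l (inj_eq val_inj).
  case: (eqVneq p x) => [<-|px] hi; last first.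
    rewrite ifN; first exact: (pruned_next I hi).
    have := mem_nth x (ltnW hi); rewrite mem_kids => /andP [/eqP gy ys].
    rewrite /l; case: (eqVneq k 0) => k0.
      by apply: contraNneq us => <-.
    have /KS [_ gl] : last p K \in K.
      by rewrite -nth_last mem_nth // ltn_predL lt0n.
    by apply: contraNneq px => e; rewrite -gl -e gy.
  rewrite size_rcons ltnS in hi; rewrite !nth_rcons hi -/k.
  have k0 : (k == 0) = false by rewrite -/k in hi; lia.
  rewrite /l k0 -nth_last nth_uniq // -/k; last by rewrite ltn_predL lt0n -/k k0.
  case: (ltnP i.+1 k) => hi1.
    rewrite (_ : (i == k.-1) = false); last by lia.
    exact: (pruned_next I hi1).
  have -> : i == k.-1 by rewrite -/k in hi; lia.
  have -> : i.+1 == k by rewrite -/k in hi; lia.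
  by [].
rewrite /prune_step gu lE -/M1.
set q := M (6 * n + p); set c := slot_choice _ _ _ _ _ _ _ _.
have qn : q < n by apply: (pruned_bound I).
have qE : k != 0 -> exists2 q' : 'I_n, q = q' & q' = nth p K k./2 /\ q' \in K.
  move=> k0; exists (nth p K k./2); last by rewrite mem_nth // half_ltn.
  by have [_ <- _] := queueP p k0.
(* The values computed by the machine agree with the definition of [H] and with the queue of [k + 1]
   children. *)
have cE : exists par mode ptr first, [/\ c = (par, mode, ptr, first),
    par = slot_parent gp (rcons s u) u,
    mode = (if odd k.+1 then 1 else 2),
    ptr = nth p (rcons K u) k.+1./2 &
    first = head p (rcons K u)].
  rewrite /c /slot_choice kv0 kv1.
  have rk : rank_of gp (rcons s u) u = k.
    by rewrite /rank_of kidsE eqxx -/k -cats1 index_cat (negPf uK') /= eqxx addn0.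
  have sp : slot_parent gp (rcons s u) u = if k == 0 then p else
      if odd k then head (nth u (rcons K u) k./2)
        (kids gp (rcons s u) (nth u (rcons K u) k./2))
      else nth u (rcons K u) k./2.
    by rewrite /slot_parent rk kidsE eqxx.
  rewrite {}sp; case: (eqVneq k 0) => k0.
    exists (val p), 1, (val u), (val u); rewrite k0 /=.
    by rewrite (size0nil k0) /=.
  have [q' qq [qn' qK]] := qE k0; have [qs gq] := KS _ qK.
  have h2 : k./2 < size K by apply: half_ltn.
  have nthq : nth u (rcons K u) k./2 = q'.
    by rewrite nth_rcons h2 qn'; apply: set_nth_default.
  have nthp : nth p (rcons K u) k./2 = q' by rewrite nth_rcons h2 qn'.
  have pq : p != q' by apply: contraNneq gus => ->.
  have firstE : M1 (5 * n + p) = head p (rcons K u).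
    rewrite M1E //; have [-> _ _] := queueP p k0.
    by rewrite -!nth0 nth_rcons lt0n -/k k0.
  rewrite nthq kidsE (negPf pq); case: ifP => ok.
    exists (val (head q' (kids gp s q'))), 2, (M1 (8 * n + q)), (M1 (5 * n + p)).
    rewrite firstE /= ok /=; split=> //.
      congr (_, _, _, _); rewrite qq !M1E // (pruned_mode I q') /=.
      case E: (kids gp s q') => [|z t] //=.
      have [|-> _ _] := queueP q'; rewrite E //=.
      by case: odd.
    rewrite qq -nthp; have := @M1next p k./2; rewrite kidsE eqxx size_rcons -/k.
    rewrite uphalf_half ok add1n => -> //; lia.
  exists (val q'), 1, (val q'), (M1 (5 * n + p)).
  by rewrite firstE /= ok /= qq uphalf_half ok add0n nthp.
case: cE => par [mode [ptr [first [-> parE modeE ptrE firstE]]]].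
have hp := ltn_ord p; have hu := ltn_ord u.
(* Besides the [k] pruned children, [u] is a neighbor of [p]; so the degree cell of [p] is positive
   and its truncated decrement is exact. *)
have deg_p : k < #|nbrs G p|.
  have uKu : uniq (rcons K u) by rewrite rcons_uniq uK' uK.
  rewrite /k -(size_rcons K u) -(card_uniqP uKu); apply: subset_leq_card.
  apply/subsetP => y; rewrite mem_rcons inE => yKu; rewrite inE.
  have [cG yr gy] : [/\ connected_graph G, y != r & gp y = p].
    case: (tree_G) => _ _ _ cG _; case/orP: yKu => [/eqP ->|/KS [ys gy]] //.
    by split=> //; apply: contraNneq (pruned_root I) => <-.
  by rewrite -gy; case: (gparentP cG yr).
split.
- by rewrite rcons_uniq us (pruned_uniq I).
- by rewrite mem_rcons inE negb_or eq_sym ur (pruned_root I).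
- move=> y yr; rewrite !mem_rcons !inE => /orP [/eqP gy|/(pruned_closed I yr) ->].
    by rewrite (kids_u y) ?orbT.
  by rewrite orbT.
- move=> y; rewrite mem_rcons inE prune_memory2 // M1E // M1E // !(inj_eq val_inj).
  case: (eqVneq y u) => [->|yu] /= ys; first by rewrite eq_sym (negPf gnu).
  rewrite (pruned_dead I ys) ifN //; by apply: contraNneq gus => <-.
- move=> y; rewrite mem_rcons inE negb_or => /andP [yu ys].
  rewrite prune_memory2 // M1E // M1E // !(inj_eq val_inj) kidsE (negPf yu) (negPf gnu).
  rewrite [p == y]eq_sym.
  case: (eqVneq y p) => [->|yp]; last exact: (pruned_deg I ys).
  have dp := pruned_deg I gus; rewrite size_rcons -/K -/k in dp *.
  by clear -dp deg_p; lia.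
- move=> y; rewrite prune_memory3 // M1E // M1E // !(inj_eq val_inj) kidsE [p == y]eq_sym.
  case: (eqVneq y p) => [->|yp]; last exact: (pruned_sum I).
  rewrite -cats1 big_cat big_seq1 /= modnDml -(pruned_sum I p) -/K.
  have -> : M (3 * n + p) + n - u + (\sum_(i <- K) i + u) =
            n + (M (3 * n + p) + \sum_(i <- K) i).
    by move: (\sum_(i <- K) i) => S; lia.
  by rewrite modnDl.
- have nu a : (if a then val u else 0) < n by case: a.
  have qptr : ptr < n /\ first < n by rewrite ptrE firstE; split; apply: ltn_ord.
  case=> [|[|[|[|[|[|[|[|[|j]]]]]]]]] // a _ _ ha.
  + by rewrite prune_memory3 //; case: ifP => _; rewrite ?ltn_mod // M1E // (pruned_bound I).
  + by rewrite prune_memory5 //; case: ifP => _; rewrite ?M1E ?(pruned_bound I) //; case: qptr.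
  + by rewrite prune_memory6 //; case: ifP => _; rewrite ?M1E ?(pruned_bound I) //; case: qptr.
  + by rewrite prune_memory7 //; case: ifP => _; rewrite ?M1E ?(pruned_bound I).
  + by rewrite prune_memory8 // /M1 /upd /=; case: ifP => _; rewrite ?(pruned_bound I).
- move=> y; rewrite prune_memory4 // M1E // !(inj_eq val_inj) kidsE [p == y]eq_sym.
  case: (eqVneq y p) => [_|yp]; last exact: (pruned_mode I).
  by rewrite size_rcons modeE.
- move=> y; rewrite prune_memory5 // prune_memory6 // prune_memory7 // !M1E //.
  rewrite !(inj_eq val_inj) kidsE [p == y]eq_sym.
  case: (eqVneq y p) => [->|yp]; last exact: (pruned_queue I).
  by move=> /= _; rewrite size_rcons last_rcons ptrE firstE.
- by move=> y i hi; rewrite prune_memory8 //; apply: M1next.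
move=> y; rewrite mem_rcons inE prune_memory_out // M1out // (inj_eq val_inj).
case: (eqVneq y u) => [->|yu] /= ys //.
by rewrite (pruned_out I) // slot_parent_rcons.
Qed.

End Invariant.

(** * Correctness of the program *)

(** Yields OPT as the least attained cost; the predicate is an arbitrary proposition, hence the
    classical case distinction. *)
Lemma ex_min_nat (P : nat -> Prop) : (exists m, P m) ->
  exists2 m, P m & forall k, P k -> m <= k.
Proof.
move=> [m]; elim/ltn_ind: m => m IH Pm.
case: (classic (exists2 k, k < m & P k)) => [[k km Pk]|h]; first exact: IH km Pk.
by exists m => // k Pk; rewrite leqNgt; apply/negP => km; apply: h; exists k.
Qed.

(** Each neighbor of [u] corresponds to exactly one listed pair, because only one orientation of an
    edge is listed. *)
Lemma sum_edge_list n (G : rel 'I_n) (l : seq ('I_n * 'I_n)) (F : 'I_n -> nat) u :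
  is_edge_list G l ->
  \sum_(y in nbrs G u) F y =
  \sum_(e <- l) ((e.1 == u) * F e.2 + (e.2 == u) * F e.1).
Proof.
move=> [ul lG anti]; rewrite big_split /=.
have sum_l (E : 'I_n * 'I_n -> nat) :
    \sum_(e <- l) E e = \sum_i \sum_j ((i, j) \in l) * E (i, j).
  rewrite big_uniq // big_mkcond pair_bigA; apply: eq_bigr => -[i j] _ /=.
  by case: (_ \in _); rewrite ?mul1n.
rewrite !sum_l /= [X in _ = _ + X]exchange_big /=.
have pick_u (E : 'I_n -> 'I_n -> nat) :
    \sum_i \sum_j (i == u) * E i j = \sum_j E u j.
  rewrite (bigD1 u) //= [X in _ + X]big1 ?addn0; last first.
    by move=> i iu; rewrite big1 // => j _; rewrite (negPf iu).
  by apply: eq_bigr => j _; rewrite eqxx mul1n.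
under [X in _ = X + _]eq_bigr do under eq_bigr do rewrite mulnCA.
under [X in _ = _ + X]eq_bigr do under eq_bigr do rewrite mulnCA.
rewrite !pick_u -big_split big_mkcond; apply: eq_bigr => y _ /=.
rewrite inE lG; have := anti u y; case: (_ \in l) => /=.
  by move/(_ isT)/negPf ->; rewrite mul1n addn0.
by case: (_ \in l); rewrite ?mul1n.
Qed.

(** The degree sum is counted twice: over the listed edges and over the parent links of the [n - 1]
    vertices other than [r]. *)
Lemma size_edge_list n (G : rel 'I_n) (r : 'I_n) l :
  is_tree G -> is_edge_list G l -> size l = n - 1.
Proof.
move=> tG lG.
have e1 : \sum_(u : 'I_n) \sum_(y in nbrs G u) 1 = 2 * size l.
  under eq_bigr do rewrite (sum_edge_list (fun=> 1) _ lG).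
  rewrite exchange_big /= -sum1_size big_distrr /=; apply: eq_bigr => e _.
  under eq_bigr do rewrite !muln1.
  rewrite big_split /= (bigD1 e.1) //= [X in _ + _ + X](bigD1 e.2) //= !eqxx.
  by rewrite !big1 // => i; rewrite eq_sym => /negPf ->.
have e2 : \sum_(u : 'I_n) \sum_(y in nbrs G u) 1 = 2 * \sum_(u | u != r) 1.
  rewrite (eq_bigr _ (fun u _ => sum_nbrs r (fun=> 1) u tG)) big_split /= mul2n -addnn; congr addn; last by rewrite -big_mkcond.
  by rewrite [RHS](partition_big (gparent G r) predT).
have : \sum_(u | u != r) 1 = n - 1.
  by rewrite sum1_card (cardC1 r) card_ord subn1.
by lia.
Qed.

Lemma nth_input n (l1 l2 : seq ('I_n * 'I_n)) e :
  let c := flatten [seq [:: val p.1; val p.2] | p <- l1 ++ e :: l2] in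
  nth 0 c (2 * size l1) = e.1 /\ nth 0 c (2 * size l1 + 1) = e.2.
Proof.
elim: l1 => [|e' l1 IH] //.
have -> : 2 * size (e' :: l1) = (2 * size l1).+2 by rewrite /= mulnS.
exact: IH.
Qed.

Lemma size_input n (l : seq ('I_n * 'I_n)) :
  size (flatten [seq [:: val p.1; val p.2] | p <- l]) = 2 * size l.
Proof. by elim: l => //= e l ->; lia. Qed.

(** * Invariants and termination of the two loops *)

Section Loops.

Variables (n : nat) (G : rel 'I_n) (r : 'I_n) (l : seq ('I_n * 'I_n)) (W : nat).
Hypotheses (tree_G : is_tree G) (r0 : val r = 0) (lG : is_edge_list G l).
Hypothesis hW : 9 * n <= W.

Let n0 : 0 < n. Proof. exact: leq_ltn_trans (ltn_ord r). Qed.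

Let input := ram (input_state l).

Definition edge_inv (m : nat) (s : state) : Prop :=
  exists l1 l2, [/\ l = l1 ++ l2, m = size l2, based n s,
    regs s count_reg = size l2 /\ regs s addr_reg = 2 * size l1 + 1 &
    [/\ forall a, (a < 2 * n) || (4 * n <= a) -> ram s a = input a,
      forall x : 'I_n, ram s (2 * n + x) =
        \sum_(e <- l1) ((e.1 == x) + (e.2 == x)) + 2 * (x == r) &
      forall x : 'I_n, ram s (3 * n + x) =
        (\sum_(e <- l1) ((e.1 == x) * e.2 + (e.2 == x) * e.1)) %% n]].

Lemma edge_inv_init s : based n s -> ram s = upd input (2 * n + 0) 2 ->
  regs s addr_reg = 1 -> regs s count_reg = n - 1 -> edge_inv (size l) s.
Proof.
move=> bs Ms h12 h11; exists [::], l; split=> //.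
  by rewrite h11 (size_edge_list r tree_G lG).
(* The input ends at cell [2 * n - 2], below all arrays. *)
have far a : 2 * n <= a -> input a = 0.
  move=> ha; rewrite /input /input_state /= nth_default //= size_input.
  by rewrite (size_edge_list r tree_G lG); lia.
rewrite Ms; split=> [a ha|x|x].
- by rewrite /upd /= ifN //; lia.
- have xr : (x == r) = (val x == 0) by rewrite -r0 (inj_eq val_inj).
  rewrite big_nil xr /upd /= eqn_add2l.
  by case: eqP => // _; apply: far; apply: leq_addr.
rewrite big_nil mod0n /upd /= cell_neq //; apply: far; lia.
Qed.

Lemma edge_step k s : edge_inv k s -> regs s count_reg != 0 ->
  runs W read_edge (max_steps read_edge)
    (fun s' => exists2 j, j < k & edge_inv j s') s.
Proof.
move=> [l1 [[|e l2] [lE -> bs [hc ha] [hin hd hS]]]] c0; first by rewrite hc in c0.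
have sl : (size l1 + size l2).+1 = n - 1.
  by rewrite -(size_edge_list r tree_G lG) lE size_cat addnS.
have [i1 i2] := nth_input l1 l2 e.
have M1 : ram s (2 * size l1 + 1) = e.1.
  rewrite hin; last by apply/orP; left; lia.
  by rewrite /input /input_state /= addn1 /= lE i1.
have M2 : ram s (2 * size l1 + 1 + 1) = e.2.
  rewrite hin; last by apply/orP; left; lia.
  by rewrite /input /input_state /= [X in nth _ _ X]addn1 /= lE i2.
have deg_le x : \sum_(e <- l1) ((e.1 == x) + (e.2 == x)) <= 2 * size l1.
  rewrite -sum1_size big_distrr /=; apply: leq_sum => e' _.
  by case: (_ == _); case: (_ == _).
apply/wp_runs/(wp_read_edge n0 hW bs (erefl _) ha hc M1 M2 (ltn_ord _) (ltn_ord _)).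
- by lia.
- move=> i hi; have := deg_le (Ordinal hi); have := hd (Ordinal hi) => /= ->.
  by move: (\sum_(_ <- _) _) => S; case: (_ == _); lia.
- by move=> i hi; have := hS (Ordinal hi) => /= ->; rewrite ltn_mod.
move=> s' bs' Ms' ha' hc'; exists (size l2) => //; exists (rcons l1 e), l2.
have far a x : (a < 2 * n) || (4 * n <= a) -> x < n ->
    a != 2 * n + x /\ a != 3 * n + x by lia.
split=> //; first by rewrite cat_rcons.
  by rewrite hc' ha' size_rcons /=; split; lia.
rewrite Ms'; split=> [a hra|x|x].
- have [f1 f2] := far a e.1 hra (ltn_ord _); have [g1 g2] := far a e.2 hra (ltn_ord _).
  by rewrite !edge_memory_neq // hin.
- rewrite !edge_memory2 // hd -cats1 big_cat big_seq1 /= !(inj_eq val_inj).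
  by rewrite ![x == _]eq_sym; lia.
rewrite !edge_memory3 // !hS -cats1 big_cat big_seq1 /= !(inj_eq val_inj).
rewrite [e.1 == x]eq_sym [e.2 == x]eq_sym.
case: (eqVneq x e.2) => [->|_]; case: (eqVneq _ e.1) => [->|_].
- by rewrite modnDml -addnA modnDml !mul1n.
- by rewrite !modnDml mul0n mul1n.
- by rewrite !modnDml mul0n mul1n addn0.
by rewrite !mul0n !addn0.
Qed.

Lemma edge_inv_final k s : edge_inv k s -> regs s count_reg = 0 ->
  based n s /\ pruned G r [::] (ram s).
Proof.
move=> [l1 [l2 [lE _ bs [hc _] [hin hd hS]]]] c0; split=> //.
have {}lE : l1 = l.
  by move: hc; rewrite c0 lE => /esym/size0nil ->; rewrite cats0.
rewrite {}lE in hd hS.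
have far a : 4 * n <= a -> ram s a = 0.
  move=> ha; rewrite hin; last by rewrite ha orbT.
  rewrite /input /input_state /= nth_default //= size_input.
  by rewrite (size_edge_list r tree_G lG); lia.
have far_cell j a : 3 < j -> ram s (j * n + a) = 0.
  by move=> hj; apply: far; have := leq_mul hj (leqnn n); lia.
split=> //.
- move=> u _; rewrite hd /= addn0 -sum1_card (sum_edge_list (fun=> 1) u lG).
  by congr addn; apply: eq_bigr => e _; rewrite !muln1.
- move=> u; rewrite big_nil addn0 hS modn_mod.
  by rewrite (sum_edge_list (fun y => val y) u lG).
- move=> j a /andP [j2 j9] j4 an; case: (eqVneq j 3) => [->|j3].
    by have := hS (Ordinal an) => /= ->; rewrite ltn_mod.
  by rewrite far_cell //; lia.
by move=> u; rewrite far_cell.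
Qed.

(** The measure adds the unscanned and the unpruned vertices. The last clause says that no vertex up
    to the scan position is a leaf, except possibly the current one: pruning can create a leaf only
    at the parent, which becomes current. *)
Definition visit_inv (m : nat) (s : state) : Prop :=
  exists ds v, [/\ based n s, pruned G r ds (ram s),
    regs s node_reg = v /\ m = regs s count_reg + (n - size ds),
    regs s count_reg <= n /\ (if regs s count_reg == 0 then v = n else v < n) &
    forall u : 'I_n, u <= n - regs s count_reg -> u <> v :> nat -> ram s (2 * n + u) <> 1].

Lemma visit_inv_init s : based n s -> pruned G r [::] (ram s) ->
  regs s count_reg = n -> regs s node_reg = 0 -> visit_inv (2 * n) s.
Proof.
move=> bs I h11 h13; exists [::], 0; split=> //.
- by rewrite h11 subn0 mul2n addnn.
- by rewrite h11 leqnn; case: eqP => // ->.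
by move=> u; rewrite h11 subnn leqn0 => /eqP u0 [].
Qed.

Lemma pruned_deg_le ds M v : pruned G r ds M -> v < n -> M (2 * n + v) <= 2 * n.
Proof.
move=> I hv; pose u := Ordinal hv; case: (boolP (u \in ds)) => hu.
  by have := pruned_dead I hu => /= ->.
have : M (2 * n + v) + _ = _ := pruned_deg I hu.
have : #|nbrs G u| < n.
  have : #|nbrs G u| < #|[set: 'I_n]|.
    apply: proper_card; rewrite properT; apply/eqP => /setP /(_ u).
    by rewrite !inE; case: tree_G => _ ->.
  by rewrite cardsT card_ord.
by case: (u == r); lia.
Qed.

Lemma visit_step k s : visit_inv k s -> regs s count_reg != 0 ->
  runs W visit (max_steps visit)
    (fun s' => exists2 j, j < k & visit_inv j s') s.
Proof.
move=> [ds [v [bs I [hv hk] [hc hvn] hleaf]]] c0.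
rewrite (negPf c0) in hvn.
apply/wp_runs/(wp_visit n0 hW bs (erefl _) hv (erefl _) hvn (pruned_bound I)).
- exact: pruned_deg_le I hvn.
- move=> nleaf s' bs' Ms' hw' hc'; exists (regs s count_reg - 1 + (n - size ds)); first by lia.
  exists ds, (n - (regs s count_reg - 1)); split=> //.
  + by rewrite Ms'.
  + by rewrite hc'.
  + rewrite hc'; split; first by lia.
    by case: eqP => h; lia.
  move=> u; rewrite hc' Ms' => hu uv; case: (eqVneq (u : nat) v) => [->//|/eqP h].
  by apply: hleaf => //; lia.
move=> leaf s' bs' Ms' hw' hc'.
have I' := @prune_pruned n G r tree_G ds (ram s) (Ordinal hvn) I leaf.
have [vds vr pds pE _] := @pruned_leaf n G r tree_G ds (ram s) (Ordinal hvn) I leaf.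
have size_le : size ds < n.
  have := max_card (mem (rcons ds (Ordinal hvn))).
  by rewrite (card_uniqP (pruned_uniq I')) size_rcons card_ord.
exists (regs s count_reg + (n - (size ds).+1)); first by rewrite hk; lia.
exists (rcons ds (Ordinal hvn)), (gparent G r (Ordinal hvn)); split=> //.
- by rewrite Ms'.
- by rewrite hw' hc' size_rcons pE.
- by rewrite hc' hc (negPf c0).
move=> u; rewrite hc' Ms' => hu up.
case: (boolP (u \in rcons ds (Ordinal hvn))) => hd.
  by rewrite (pruned_dead I' hd).
move: hd; rewrite mem_rcons inE negb_or => /andP [uv uds].
have uv' : u <> v :> nat by move=> e; case/eqP: uv; apply: val_inj.
have := hleaf u hu uv'; have := pruned_deg I uds; have := pruned_deg I' (u := u).
rewrite mem_rcons inE negb_or uv uds => /(_ isT).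
rewrite kids_rcons ifN; last by apply/eqP => e; apply: up; rewrite -e.
move=> h1 h2 h3 h4; apply: h3; apply: (@addIn (size (kids (gparent G r) ds u))).
by rewrite h2 -h1 h4.
Qed.

(** Among the unpruned vertices other than the root, one farthest from the root would have all its
    children pruned and hence be a leaf, but none is left. *)
Lemma visit_inv_final k s : visit_inv k s -> regs s count_reg = 0 ->
  exists ds, [/\ based n s, pruned G r ds (ram s) & forall u, (u \in ds) = (u != r)].
Proof.
move=> [ds [v [bs I [hv hk] [hc hvn] hleaf]]] c0; exists ds; split=> // u.
rewrite c0 eqxx in hvn; rewrite {}hvn c0 subn0 in hleaf.
have {hleaf} no_leaf (z : 'I_n) : ram s (2 * n + z) <> 1.
  by have hz := ltn_ord z; apply: hleaf; lia.
have rds := pruned_root I.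
apply/idP/idP => [uds|ur]; first by apply: contraNneq rds => <-.
apply/negPn/negP => uds.
pose P := [pred z : 'I_n | (z != r) && (z \notin ds)].
have Pu : P u by rewrite /= ur uds.
case: (@arg_maxnP _ u P (dist G r) Pu) => z /= /andP [zr zds] zmax.
apply: (no_leaf z); have := pruned_deg I zds.
rewrite (negPf zr) muln0 addn0 -sum1_card (sum_nbrs r (fun=> 1) z tree_G) zr.
have -> : \sum_(y | (y != r) && (gparent G r y == z)) 1 =
          size (kids (gparent G r) ds z).
  rewrite -sum1_size (kids_sum G r z (fun=> 1) (pruned_uniq I)).
  apply: eq_bigl => y; apply/andP/andP => -[h1 h2]; split=> //.
    apply/negPn/negP => yds; have := zmax y; rewrite /= h1 yds => /(_ isT).
    by have := gp_dec tree_G h1; rewrite (eqP h2) ltnNge => /negPf ->.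
  by apply: contraNneq rds => <-.
by lia.
Qed.

Lemma program_correct :
  runs W program
    (max_steps prologue + (((max_steps read_edge).+1 * (n - 1)).+1 +
      (2 + (((max_steps visit).+1 * (2 * n)).+1 + 1))))
    (fun s => exists ds, [/\ uniq ds, forall u, (u \in ds) = (u != r),
       ram s 0 = 0 &
       forall u, u \in ds -> ram s u.+1 = slot_parent (gparent G r) ds u])
    (input_state l).
Proof.
apply: (@runs_seq W prologue _ (max_steps prologue)); apply: wp_runs.
apply: (wp_prologue n0 hW) => // s1 bs1 Ms1 ha1 hc1.
rewrite -(size_edge_list r tree_G lG).
apply: (@runs_seq W _ _ ((max_steps read_edge).+1 * size l).+1).
apply: (runs_mono (runs_while edge_step (edge_inv_init bs1 Ms1 ha1 hc1))).
move=> s2 [c2 [k2 I2]]; have [bs2 {}I2] := edge_inv_final I2 c2.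
apply: (@runs_seq W _ _ 2); apply: (@wp_runs W (Add count_reg 1 0 ;; Const node_reg 0)).
have r1 : regs s2 1 = n by rewrite (proj1 bs2) // mul1n.
have rz : regs s2 0 = 0 by rewrite (proj1 bs2).
have hWn : n + 0 <= W by lia.
apply: wp_seq; apply: (wp_add bs2 _ r1 rz hWn) => // s3 bs3 Ms3 h3 k3.
apply: (wp_const bs3) => // s4 bs4 Ms4 h4 k4.
apply: (@runs_seq W _ _ ((max_steps visit).+1 * (2 * n)).+1).
have I4 : visit_inv (2 * n) s4.
  by apply: visit_inv_init; rewrite ?Ms4 ?Ms3 // k4 // h3 addn0.
apply: (runs_mono (runs_while visit_step I4)).
move=> s5 [c5 [k5 I5]]; have [ds [bs5 {}I5 dsE]] := visit_inv_final I5 c5.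
have z5 : regs s5 0 = 0 by rewrite (proj1 bs5).
apply: (@wp_runs W (Write 0 0)); rewrite /= z5; exists ds; split=> //.
  exact: pruned_uniq I5.
by move=> u /(pruned_out I5) /=; rewrite addn1.
Qed.

End Loops.

(** One constant serves time and word size. The 5 collects the two failing loop tests, the two
    instructions between the loops and the final write; [n >= 1] absorbs the additive terms. *)
Definition step_factor : nat :=
  max_steps prologue + (max_steps read_edge).+1 + 2 * (max_steps visit).+1 + 5.

Theorem theorem1 :
  exists (P : cmd) (c : nat),
  forall (n : nat) (G : rel 'I_n) (l : seq ('I_n * 'I_n)),
    is_tree G -> is_edge_list G l ->
    exists (t : nat) (s : state) (H : rel 'I_n) (r : 'I_n),
      [/\ exec (c * n) P (input_state l) t s,
          t <= c * n,
          represents s H r,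
          is_binary_tree H r &
          exists2 opt : nat, is_opt G opt & cost G H <= 4 * opt].
Proof.
exists program, step_factor => n G l tG lG.
have n0 : 0 < n by case: tG => _ _; rewrite card_ord.
pose r : 'I_n := Ordinal n0.
(* All arrays lie below address [9 * n], so words of this size can address them. *)
have hW : 9 * n <= step_factor * n by rewrite leq_mul2r orbC; vm_compute.
have [t [s [ex ht [ds [uds dsE s0 sE]]]]] := program_correct tG (erefl : val r = 0) lG hW.
have [bH low] := slot_tree_cost tG uds dsE.
have dec v : v != r -> dist G r (gparent G r v) < dist G r v := gp_dec tG (u := v).
have [phi hphi] := slot_parent_dec dec uds dsE.
exists t, s, (parent_graph r (slot_parent (gparent G r) ds)), r; split=> //.
- apply: (leq_trans ht); rewrite /step_factor.
  move: (max_steps _) (max_steps _) (max_steps _) => a b c.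
  by nia.
- split=> // p v; rewrite (parent_graph_children p hphi) inE => /andP [vr /eqP <-].
  by rewrite sE // dsE.
have [m [h [r' [bh hm]]] mmin] : exists2 m,
    exists (h : rel 'I_n) (r' : 'I_n), is_binary_tree h r' /\ cost G h = m &
    forall k, (exists (h : rel 'I_n) (r' : 'I_n), is_binary_tree h r' /\ cost G h = k) -> m <= k.
  by apply: ex_min_nat; eexists; exists (parent_graph r (slot_parent (gparent G r) ds)), r.
exists m; last by rewrite -hm; apply: low bh.
split; first by exists h, r'.
by move=> h' r'' bh'; apply: mmin; exists h', r''.
Qed.
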